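(* Consider two parallel lax tangent morphisms $(F,\alpha),(G,\beta):(\mathbb X,\mathbb T)\to(\mathbb X',\mathbb T')$ of tangentads in a 2-category $\mathbf K$. Assume that $(G,\beta)$ is a strong tangent morphism which preserves the fundamental tangent limits. If there exists an inserter $\mathbb I:F\Rightarrow G$ of $F$ and $G$ in $\mathbf K$, with universal 1-morphism $V:\mathbb I\to\mathbb X$ and universal 2-morphism $\hat\theta:F\circ V\Rightarrow G\circ V$, then $\mathbb I$ comes equipped with a tangent structure $\mathbb T^{\mathbb I}$ such that $V$ becomes a strict tangent morphism that preserves the fundamental tangent limits, $\hat\theta$ becomes a tangent 2-morphism, and $(\mathbb I,\mathbb T^{\mathbb I}):(F,\alpha)\Rightarrow(G,\beta)$ becomes an inserter of $(F,\alpha)$ and $(G,\beta)$ in $\mathsf{Tng}(\mathbf K)$. In particular, if $\mathbf K$ admits inserters, so does $\mathsf{Tng}_{\cong}(\mathbf K)$.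
   Context: Let $\mathbf K$ be a 2-category. For a 2-morphism $\varphi$ and a 1-morphism $H$, write $H\varphi$ and $\varphi_H$ for the whiskerings (post- and precomposition with $H$). A pullback in $\mathbf K(\mathbb X,\mathbb Y)$ is pointwise if it is preserved by $\mathbf K(F,\mathbb Y)$ for every 1-morphism $F:\mathbb X'\to\mathbb X$. Tangentad: a tangentad $(\mathbb X,\mathbb T)$ in $\mathbf K$ is an object $\mathbb X$ with a tangent structure $\mathbb T=(T,p,z,s,l,c)$: a 1-morphism $T:\mathbb X\to\mathbb X$ and 2-morphisms $p:T\Rightarrow\mathrm{id}$, $z:\mathrm{id}\Rightarrow T$, $s:T_2\Rightarrow T$, $l:T\Rightarrow T^2$, $c:T^2\Rightarrow T^2$ such that: (1) for each $n\ge1$ the $n$-fold pullback $T_n$ of $p$ along itself (projections $\pi_k:T_n\Rightarrow T$) exists in $\mathbf K(\mathbb X,\mathbb X)$, is pointwise, and is preserved by postcomposition with all iterates $T^m$; (2) $pz=\mathrm{id}$, $ps=p\pi_1$, and $s$ is associative, commutative and unital with unit $z$; (3) $Tp\circ l=z\circ p$, $l\circ z=Tz\circ z$, $l\circ s=Ts\circ\langle l\pi_1,l\pi_2\rangle$; (4) $p_T\circ c=Tp$, $c\circ Tz=z_T$, $c\circ Ts=s_T\circ\langle c\circ T\pi_1,c\circ T\pi_2\rangle$; (5) $Tl\circ l=l_T\circ l$, $c\circ l=l$, $c_T\circ Tc\circ l_T=Tl\circ c$, $c\circ c=\mathrm{id}$, $Tc\circ c_T\circ Tc=c_T\circ Tc\circ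 c_T$; (6) the square with top $Ts\circ\langle l\pi_1,z_T\pi_2\rangle:T_2\Rightarrow T^2$, left side $p\pi_1:T_2\Rightarrow\mathrm{id}$, right side $Tp:T^2\Rightarrow T$ and bottom $z:\mathrm{id}\Rightarrow T$ is a pointwise pullback. The fundamental tangent limits of $(\mathbb X,\mathbb T)$ are the pullbacks $T_n$ and the pullback in (6). Morphisms: a lax tangent morphism $(F,\alpha):(\mathbb X,\mathbb T)\to(\mathbb X',\mathbb T')$ is a 1-morphism $F:\mathbb X\to\mathbb X'$ with a 2-morphism $\alpha:F\circ T\Rightarrow T'\circ F$ such that $p'_F\circ\alpha=Fp$, $\alpha\circ Fz=z'_F$, $\alpha\circ Fs=s'_F\circ\langle\alpha\circ F\pi_1,\alpha\circ F\pi_2\rangle$, $l'_F\circ\alpha=T'\alpha\circ\alpha_T\circ Fl$, $c'_F\circ T'\alpha\circ\alpha_T=T'\alpha\circ\alpha_T\circ Fc$. It is strong if $\alpha$ is invertible, strict if $\alpha$ is an identity. It preserves the fundamental tangent limits if the postcomposition functor $\mathbf K(\mathbb X,F):\mathbf K(\mathbb X,\mathbb X)\to\mathbf K(\mathbb X,\mathbb X')$ preserves the fundamental tangent limits of $(\mathbb X,\mathbb T)$ in a pointwise way. A tangent 2-morphism $\varphi:(F,\alpha)\Rightarrow(G,\beta)$ is a 2-morphism $\varphi:F\Rightarrow G$ with $T'\varphi\circ\alpha=\beta\circ\varphi_T$. $\mathsf{Tng}(\mathbf K)$ (resp. $\mathsf{Tng}_{\cong}(\mathbf K)$) is the 2-category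 of tangentads of $\mathbf K$, lax (resp. strong) tangent morphisms and tangent 2-morphisms. Inserter: for 1-morphisms $F,G:\mathbb X\to\mathbb X'$ and an object $\mathbb Y$, $\mathsf{Insert}[\mathbb Y;F,G]$ is the category of pairs $(H:\mathbb Y\to\mathbb X,\ \tau:F\circ H\Rightarrow G\circ H)$ with morphisms $(H,\tau)\to(H',\tau')$ the 2-morphisms $\varphi:H\Rightarrow H'$ with $\tau'\circ F\varphi=G\varphi\circ\tau$. An inserter $\mathbb I:F\Rightarrow G$ is an object $\mathbb I$ with $V:\mathbb I\to\mathbb X$ and $\hat\theta:F\circ V\Rightarrow G\circ V$ such that $\mathbf K(\mathbb Y,\mathbb I)\to\mathsf{Insert}[\mathbb Y;F,G]$, $H\mapsto(V\circ H,\hat\theta_H)$, $\psi\mapsto V\psi$, is an isomorphism of categories for every $\mathbb Y$.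
   Formalization: The last sentence, false for all strong morphisms, is proved for pairs in Tng_≅(K) whose G preserves the fundamental tangent limits, and for the 2-category of strong morphisms preserving them; preservation of T_n by the iterates T^m is taken pointwise. *)

(* Defs.v *)
From Stdlib Require Import ProofIrrelevance ClassicalEpsilon.
From mathcomp Require Import all_boot.

Set Implicit Arguments.
Unset Strict Implicit.
Unset Printing Implicit Defensive.

Declare Scope cell_scope.
Delimit Scope cell_scope with cell.
Local Open Scope cell_scope.

Record category := Category {
  obj :> Type;
  arr : obj -> obj -> Type;
  idt : forall a, arr a a;
  comp : forall a b c, arr b c -> arr a b -> arr a c;
  comp1l : forall a b (f : arr a b), comp (idt b) f = f;
  comp1r : forall a b (f : arr a b), comp f (idt a) = f;
  compA : forall a b c d (h : arr c d) (g : arr b c) (f : arr a b),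
    comp h (comp g f) = comp (comp h g) f }.

Arguments idt {C} a : rename.
Arguments comp {C a b c} _ _ : rename.
Notation "a ⇒ b" := (arr a b) (at level 99, b at level 200) : type_scope.

(* Strict 2-categories only satisfy their associativity and unit laws for
   1-morphisms up to propositional equality.  Composition of arrows therefore
   transports along an equality between the codomain of the first arrow and
   the domain of the second one; this equality is found by type class
   resolution, from the strict laws (see the hint below). *)
Class strict (A : Type) (a b : A) : Prop := strict_eq : a = b.

Definition compE (C : category) (a b b' c : C) (e : strict b b')
    (g : b' ⇒ c) (f : a ⇒ b) : a ⇒ c :=
  comp g (eq_rect b (fun x => a ⇒ x) f b' e).
Arguments compE {C a b b' c e} g f.
Notation "g • f" := (compE g f) (at level 45, left associativity) : cell_scope.

(* Equality of arrows whose (co)domains are only propositionally equal: the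
   endpoints agree and, after identifying them, so do the arrows. *)
Inductive heq (C : category) (a b : C) (f : a ⇒ b) :
    forall a' b' : C, (a' ⇒ b') -> Prop :=
  heq_refl : heq f f.
Notation "f ≈ g" := (heq f g) (at level 70) : cell_scope.

#[export] Hint Extern 0 (strict _ _) => reflexivity : typeclass_instances.

Definition is_invertible (C : category) (a b : C) (f : a ⇒ b) : Prop :=
  exists g : b ⇒ a, comp g f = idt a /\ comp f g = idt b.

Record functor (C D : category) := Functor {
  fob :> C -> D;
  fmap : forall a b : C, (a ⇒ b) -> (fob a ⇒ fob b);
  fmap_id : forall a, fmap (idt a) = idt (fob a);
  fmap_comp : forall (a b c : C) (g : b ⇒ c) (f : a ⇒ b),
    fmap (comp g f) = comp (fmap g) (fmap f) }.
Arguments fmap {C D} Phi {a b} _ : rename.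

Definition is_isomorphism (C D : category) (Phi : functor C D) : Prop :=
  exists Psi : functor D C,
    [/\ forall a, Psi (Phi a) = a,
        forall a b (f : a ⇒ b), fmap Psi (fmap Phi f) ≈ f,
        forall a, Phi (Psi a) = a &
        forall a b (f : a ⇒ b), fmap Phi (fmap Psi f) ≈ f].

Section Limits.
Variable C : category.

Definition is_nfold_pullback (a b : C) (p : a ⇒ b) (n : nat)
    (P : C) (pi : 'I_n -> (P ⇒ a)) : Prop :=
  (forall i j, comp p (pi i) = comp p (pi j)) /\
  forall (Q : C) (q : 'I_n -> (Q ⇒ a)),
    (forall i j, comp p (q i) = comp p (q j)) ->
    exists! u : Q ⇒ P, forall i, comp (pi i) u = q i.

(*    P --f--> a
      |        |
      g        h
      v        v
      b --k--> c      *)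
Definition is_pullback (P a b c : C)
    (f : P ⇒ a) (g : P ⇒ b) (h : a ⇒ c) (k : b ⇒ c) : Prop :=
  comp h f = comp k g /\
  forall (Q : C) (x : Q ⇒ a) (y : Q ⇒ b), comp h x = comp k y ->
    exists! u : Q ⇒ P, comp f u = x /\ comp g u = y.

End Limits.

Record twocat := TwoCat {
  ob :> Type;
  hom : ob -> ob -> category;
  id1 : forall X, hom X X;
  comp1 : forall X Y Z, hom Y Z -> hom X Y -> hom X Z;
  whl : forall X Y Z (H : hom Y Z) (F F' : hom X Y),
    (F ⇒ F') -> (comp1 H F ⇒ comp1 H F');
  whr : forall X Y Z (H H' : hom Y Z) (F : hom X Y),
    (H ⇒ H') -> (comp1 H F ⇒ comp1 H' F);
  comp1_idl : forall X Y (F : hom X Y), comp1 (id1 Y) F = F;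
  comp1_idr : forall X Y (F : hom X Y), comp1 F (id1 X) = F;
  comp1_assoc : forall X Y Z W (H : hom Z W) (G : hom Y Z) (F : hom X Y),
    comp1 H (comp1 G F) = comp1 (comp1 H G) F;
  whl_id : forall X Y Z (H : hom Y Z) (F : hom X Y),
    whl H (idt F) = idt (comp1 H F);
  whl_comp : forall X Y Z (H : hom Y Z) (F F' F'' : hom X Y)
    (psi : F' ⇒ F'') (phi : F ⇒ F'),
    whl H (comp psi phi) = comp (whl H psi) (whl H phi);
  whr_id : forall X Y Z (H : hom Y Z) (F : hom X Y),
    whr F (idt H) = idt (comp1 H F);
  whr_comp : forall X Y Z (H H' H'' : hom Y Z) (F : hom X Y)
    (psi : H' ⇒ H'') (phi : H ⇒ H'),
    whr F (comp psi phi) = comp (whr F psi) (whr F phi);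
  whl_id1 : forall X Y (F F' : hom X Y) (phi : F ⇒ F'), whl (id1 Y) phi ≈ phi;
  whr_id1 : forall X Y (F F' : hom X Y) (phi : F ⇒ F'), whr (id1 X) phi ≈ phi;
  whl_comp1 : forall X Y Z W (H : hom Z W) (G : hom Y Z) (F F' : hom X Y)
    (phi : F ⇒ F'), whl (comp1 H G) phi ≈ whl H (whl G phi);
  whr_comp1 : forall X Y Z W (H H' : hom Z W) (G : hom Y Z) (F : hom X Y)
    (phi : H ⇒ H'), whr (comp1 G F) phi ≈ whr F (whr G phi);
  whl_whr : forall X Y Z W (H : hom Z W) (G G' : hom Y Z) (F : hom X Y)
    (phi : G ⇒ G'), whr F (whl H phi) ≈ whl H (whr F phi);
  interchange : forall X Y Z (H H' : hom Y Z) (F F' : hom X Y)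
    (psi : H ⇒ H') (phi : F ⇒ F'),
    comp (whr F' psi) (whl H phi) = comp (whl H' phi) (whr F psi) }.

Arguments hom {t} _ _.
Arguments id1 {t X}.
Arguments comp1 {t X Y Z} H F : rename.
Arguments whl {t X Y Z} H {F F'} _.
Arguments whr {t X Y Z H H'} F _.

Notation "H ∘ F" := (comp1 H F) (at level 40, left associativity) : cell_scope.
Notation "H ◁ phi" := (whl H phi) (at level 42, right associativity) : cell_scope.
Notation "phi ▷ F" := (whr F phi) (at level 43, left associativity) : cell_scope.

#[export] Hint Extern 1 (strict _ _) =>
  solve [ unfold strict; simpl;
          rewrite ?comp1_assoc ?comp1_idl ?comp1_idr ?comp1_assoc;
          reflexivity ] : typeclass_instances.

(* K(Y,H) : K(Y,X) -> K(Y,X'), postcomposition with H. *)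
Definition postcomp (K : twocat) (Y X X' : K) (H : hom X X') :
    functor (hom Y X) (hom Y X') :=
  @Functor (hom Y X) (hom Y X') (fun F => H ∘ F) (fun F F' phi => H ◁ phi)
    (@whl_id K Y X X' H) (fun F F' F'' psi phi => @whl_comp K Y X X' H _ _ _ psi phi).

(* K(F,Y) : K(X,Y) -> K(X',Y), precomposition with F. *)
Definition precomp (K : twocat) (Y X X' : K) (F : hom X' X) :
    functor (hom X Y) (hom X' Y) :=
  @Functor (hom X Y) (hom X' Y) (fun H => H ∘ F) (fun H H' phi => phi ▷ F)
    (fun H => @whr_id K X' X Y H F) (fun H H' H'' psi phi => @whr_comp K X' X Y _ _ _ F psi phi).

Section Pointwise.
Variables (K : twocat) (X Y : K).

Definition pointwise_nfold_pullback (A B : hom X Y) (p : A ⇒ B) (n : nat)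
    (P : hom X Y) (pi : 'I_n -> (P ⇒ A)) : Prop :=
  is_nfold_pullback p pi /\
  forall (X' : K) (F : hom X' X),
    is_nfold_pullback (fmap (precomp Y F) p) (fun i => fmap (precomp Y F) (pi i)).

Definition pointwise_pullback (P A B C : hom X Y)
    (f : P ⇒ A) (g : P ⇒ B) (h : A ⇒ C) (k : B ⇒ C) : Prop :=
  is_pullback f g h k /\
  forall (X' : K) (F : hom X' X),
    is_pullback (fmap (precomp Y F) f) (fmap (precomp Y F) g)
                (fmap (precomp Y F) h) (fmap (precomp Y F) k).

End Pointwise.

Fixpoint iter1 (K : twocat) (X : K) (T : hom X X) (m : nat) : hom X X :=
  if m is m'.+1 then T ∘ iter1 T m' else id1.

(* [u = ⟨a, b⟩] with respect to the projections [pi1] and [pi2]. *)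
Definition is_pairing (C : category) (P A Q : C) (pi1 pi2 : P ⇒ A)
    (a b : Q ⇒ A) (u : Q ⇒ P) : Prop :=
  comp pi1 u = a /\ comp pi2 u = b.

(* [Tn n] is the n-fold pullback of [p] along itself; only the values at
   [n >= 1] are meaningful. *)
Record tangent_data (K : twocat) (X : K) := TangentData {
  tT : hom X X;
  tp : tT ⇒ id1;
  tz : id1 ⇒ tT;
  Tn : nat -> hom X X;
  tpi : forall n, 'I_n -> (Tn n ⇒ tT);
  ts : Tn 2 ⇒ tT;
  tl : tT ⇒ tT ∘ tT;
  tc : tT ∘ tT ⇒ tT ∘ tT }.

Arguments tpi {K X} t n _.

Section TangentAxioms.
Variables (K : twocat) (X : K) (D : tangent_data X).
Local Notation T := (tT D).
Local Notation p := (tp D).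
Local Notation z := (tz D).
Local Notation s := (ts D).
Local Notation l := (tl D).
Local Notation c := (tc D).

Definition pi1 : Tn D 2 ⇒ T := tpi D 2 ord0.
Definition pi2 : Tn D 2 ⇒ T := tpi D 2 ord_max.
Definition pi3_ (k : 'I_3) : Tn D 3 ⇒ T := tpi D 3 k.
Local Notation π31 := (pi3_ ord0).
Local Notation π32 := (pi3_ (@Ordinal 3 1 isT)).
Local Notation π33 := (pi3_ ord_max).

(* Wherever a pairing ⟨a, b⟩ occurs in the equations below, it is the unique
   [u] with [is_pairing _ _ a b u]. *)

(* As for the fibre powers of [p] themselves, preservation by the iterates
   [T^m] is meant pointwise: [T^m ∘ Tn n] is again a pointwise pullback. *)
Definition tn_pullbacks : Prop :=
  forall n, 0 < n ->
    pointwise_nfold_pullback p (tpi D n) /\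
    forall m, let Tm := postcomp X (iter1 T m) in
      pointwise_nfold_pullback (fmap Tm p) (fun k => fmap Tm (tpi D n k)).

Definition s_assoc : Prop :=
  exists u12 u23 : Tn D 3 ⇒ Tn D 2, exists v w : Tn D 3 ⇒ Tn D 2,
    [/\ is_pairing pi1 pi2 π31 π32 u12, is_pairing pi1 pi2 π32 π33 u23,
        is_pairing pi1 pi2 (s • u12) π33 v, is_pairing pi1 pi2 π31 (s • u23) w &
        s • v ≈ s • w].

Definition s_comm : Prop :=
  exists2 u : Tn D 2 ⇒ Tn D 2, is_pairing pi1 pi2 pi2 pi1 u & s • u ≈ s.

Definition s_unital : Prop :=
  exists2 u : T ⇒ Tn D 2, is_pairing pi1 pi2 (idt T) (z • p) u & s • u ≈ idt T.

Definition l_additive : Prop :=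
  exists2 u : Tn D 2 ⇒ T ∘ Tn D 2,
    is_pairing (T ◁ pi1) (T ◁ pi2) (l • pi1) (l • pi2) u &
    l • s ≈ (T ◁ s) • u.

Definition c_additive : Prop :=
  exists2 u : T ∘ Tn D 2 ⇒ Tn D 2 ∘ T,
    is_pairing (pi1 ▷ T) (pi2 ▷ T) (c • (T ◁ pi1)) (c • (T ◁ pi2)) u &
    c • (T ◁ s) ≈ (s ▷ T) • u.

(* [mu = Ts • ⟨l • pi1, z_T • pi2⟩], the top side of the square expressing the
   universality of the vertical lift. *)
Definition is_vlift (mu : Tn D 2 ⇒ T ∘ T) : Prop :=
  exists2 u : Tn D 2 ⇒ T ∘ Tn D 2,
    is_pairing (T ◁ pi1) (T ◁ pi2) (l • pi1) ((z ▷ T) • pi2) u &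
    mu = (T ◁ s) • u.

(* The right side [Tp : T ∘ T ⇒ T ∘ id1 = T] of the same square. *)
Definition Tp : T ∘ T ⇒ T := idt T • (T ◁ p).

Record tangent_axioms : Prop := TangentAxioms {
  ax_Tn : tn_pullbacks;
  ax_pz : p • z ≈ idt id1;
  ax_ps : p • s ≈ p • pi1;
  ax_s_assoc : s_assoc;
  ax_s_comm : s_comm;
  ax_s_unital : s_unital;
  ax_lp : (T ◁ p) • l ≈ z • p;
  ax_lz : l • z ≈ (T ◁ z) • z;
  ax_ls : l_additive;
  ax_cp : (p ▷ T) • c ≈ T ◁ p;
  ax_cz : c • (T ◁ z) ≈ z ▷ T;
  ax_cs : c_additive;
  ax_ll : (T ◁ l) • l ≈ (l ▷ T) • l;
  ax_cl : c • l ≈ l;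
  ax_ccl : (c ▷ T) • (T ◁ c) • (l ▷ T) ≈ (T ◁ l) • c;
  ax_cc : c • c ≈ idt (T ∘ T);
  ax_yb : (T ◁ c) • (c ▷ T) • (T ◁ c) ≈ (c ▷ T) • (T ◁ c) • (c ▷ T);
  ax_vlift : exists2 mu : Tn D 2 ⇒ T ∘ T, is_vlift mu &
    pointwise_pullback mu (p • pi1) Tp z }.

End TangentAxioms.

Record tangent_structure (K : twocat) (X : K) := TangentStructure {
  tdata :> tangent_data X;
  tax : tangent_axioms tdata }.

Record tangentad (K : twocat) := Tangentad {
  carrier :> ob K;
  tstr : tangent_structure carrier }.

Section TangentMorphisms.
Variables (K : twocat) (X X' : tangentad K).
Local Notation D := (tdata (tstr X)).
Local Notation D' := (tdata (tstr X')).
Local Notation T := (tT D).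
Local Notation T' := (tT D').

Record is_lax (F : hom X X') (a : F ∘ T ⇒ T' ∘ F) : Prop := IsLax {
  lax_p : (tp D' ▷ F) • a ≈ F ◁ tp D;
  lax_z : a • (F ◁ tz D) ≈ tz D' ▷ F;
  lax_s : exists2 u : F ∘ Tn D 2 ⇒ Tn D' 2 ∘ F,
    is_pairing (pi1 D' ▷ F) (pi2 D' ▷ F) (a • (F ◁ pi1 D)) (a • (F ◁ pi2 D)) u &
    a • (F ◁ ts D) ≈ (ts D' ▷ F) • u;
  lax_l : (tl D' ▷ F) • a ≈ (T' ◁ a) • (a ▷ T) • (F ◁ tl D);
  lax_c : (tc D' ▷ F) • (T' ◁ a) • (a ▷ T) ≈ (T' ◁ a) • (a ▷ T) • (F ◁ tc D) }.

Record lax_mor := LaxMor {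
  mor1 : hom X X';
  dist : mor1 ∘ T ⇒ T' ∘ mor1;
  lax_ax : is_lax dist }.

Definition is_strong (F : lax_mor) : Prop := is_invertible (dist F).

(* [≈] also asserts [mor1 F ∘ T = T' ∘ mor1 F]. *)
Definition is_strict (F : lax_mor) : Prop := dist F ≈ idt (mor1 F ∘ T).

(* The fundamental tangent limits (ftl) are the pullbacks [Tn n] and the square
   of the universality of the vertical lift. *)
Definition preserves_ftl (F : hom X X') : Prop :=
  let KF := postcomp X F in
  (forall n, 0 < n ->
     pointwise_nfold_pullback (fmap KF (tp D)) (fun k => fmap KF (tpi D n k))) /\
  (forall mu, is_vlift mu ->
     pointwise_pullback (fmap KF mu) (fmap KF (tp D • pi1 D))
                        (fmap KF (Tp D)) (fmap KF (tz D))).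

Definition is_tangent2 (F G : lax_mor) (phi : mor1 F ⇒ mor1 G) : Prop :=
  (T' ◁ phi) • dist F ≈ dist G • (phi ▷ T).

End TangentMorphisms.

Arguments is_tangent2 {K X X'} F G phi.

Record tangent2 (K : twocat) (X X' : tangentad K) (F G : lax_mor X X') := Tangent2 {
  cell2 :> mor1 F ⇒ mor1 G;
  tangent2_ax : is_tangent2 F G cell2 }.

(* An arrow together with its endpoints; [None] stands for an undefined
   composite, so that [mcomp] is associative without side conditions. *)
Definition mor (C : category) := option {a : C & {b : C & a ⇒ b}}.

Definition tot (C : category) (a b : C) (f : a ⇒ b) : mor C :=
  Some (existT _ a (existT _ b f)).

Definition mcomp (C : category) (g f : mor C) : mor C :=
  match g, f with
  | Some (existT b' (existT c g)), Some (existT a (existT b f)) =>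
    match excluded_middle_informative (b = b') with
    | left e => tot (@compE C a b b' c e g f)
    | right _ => None
    end
  | _, _ => None
  end.
Notation "g ⊙ f" := (mcomp g f) (at level 45, left associativity) : cell_scope.

Section Calculus.
Variable C : category.
Implicit Types a b c d : C.

Lemma heq_tot a b (f : a ⇒ b) a' b' (g : a' ⇒ b') : f ≈ g <-> tot f = tot g.
Proof.
split=> [[] // | E].
suff: if tot g is Some (existT _ (existT _ h)) then f ≈ h else False by [].
by rewrite -E.
Qed.

Lemma tot_inj a b (f g : a ⇒ b) : tot f = tot g -> f = g.
Proof.
move=> E; injection E => E1; exact: inj_pair2 (inj_pair2 _ _ _ _ _ E1).
Qed.

Lemma heq_eq a b (f g : a ⇒ b) : f ≈ g <-> f = g.
Proof. by rewrite heq_tot; split=> [/tot_inj | ->]. Qed.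

Lemma heq_sym a b (f : a ⇒ b) a' b' (g : a' ⇒ b') : f ≈ g -> g ≈ f.
Proof. by case. Qed.

Lemma heq_trans a b (f : a ⇒ b) a' b' (g : a' ⇒ b') a'' b'' (h : a'' ⇒ b'') :
  f ≈ g -> g ≈ h -> f ≈ h.
Proof. by case=> // ?; case. Qed.

Lemma compE_comp a b c (g : b ⇒ c) (f : a ⇒ b) (e : strict b b) :
  @compE C a b b c e g f = comp g f.
Proof. by rewrite (proof_irrelevance _ e (erefl b)). Qed.

Lemma tot_compE a b b' c (e : strict b b') (g : b' ⇒ c) (f : a ⇒ b) :
  tot (@compE C a b b' c e g f) = tot g ⊙ tot f.
Proof.
rewrite /=; case: excluded_middle_informative => [e' | //].
by rewrite (proof_irrelevance _ e e').
Qed.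

Lemma tot_comp a b c (g : b ⇒ c) (f : a ⇒ b) :
  tot (comp g f) = tot g ⊙ tot f.
Proof. by rewrite -(@tot_compE _ _ _ _ (erefl b)). Qed.

Lemma mcompA : associative (@mcomp C).
Proof.
move=> [[a3 [b3 f3]]|//] [[a2 [b2 f2]]|//] [[a1 [b1 f1]]|] /=; last first.
  by case: excluded_middle_informative.
case: excluded_middle_informative => [e1|n1]; last first.
  case: excluded_middle_informative => [e2|n2] //=.
  by case: excluded_middle_informative.
subst a2; rewrite /=; case: excluded_middle_informative => [e2|n2] //=.
subst a3; case: excluded_middle_informative => // e1.
by rewrite !compE_comp compA.
Qed.

Lemma mcomp_idl a b b' (f : a ⇒ b) : b = b' -> tot (idt b') ⊙ tot f = tot f.
Proof. by move=> e; rewrite -(@tot_compE _ _ _ _ e); case: _ / e; rewrite compE_comp comp1l. Qed.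

Lemma mcomp_idr a b a' (f : a ⇒ b) : a' = a -> tot f ⊙ tot (idt a') = tot f.
Proof. by move=> e; rewrite -(@tot_compE _ _ _ _ e); case: _ / e f => f; rewrite compE_comp comp1r. Qed.

Lemma tot_idt a b : a = b -> tot (idt a) = tot (idt b).
Proof. by move->. Qed.

End Calculus.

Section Whiskering.
Variable K : twocat.

Definition mwhl (X Y Z : K) (H : hom Y Z) (m : mor (hom X Y)) : mor (hom X Z) :=
  omap (fun m => let: existT F (existT F' phi) := m in
     existT _ (H ∘ F) (existT _ (H ∘ F') (H ◁ phi))) m.
Definition mwhr (X Y Z : K) (F : hom X Y) (m : mor (hom Y Z)) : mor (hom X Z) :=
  omap (fun m => let: existT H (existT H' phi) := m in
     existT _ (H ∘ F) (existT _ (H' ∘ F) (phi ▷ F))) m.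

Variables X Y Z W : K.

Lemma tot_whl (H : hom Y Z) (F F' : hom X Y) (phi : F ⇒ F') :
  tot (H ◁ phi) = mwhl H (tot phi).
Proof. by []. Qed.

Lemma tot_whr (H H' : hom Y Z) (F : hom X Y) (phi : H ⇒ H') :
  tot (phi ▷ F) = mwhr F (tot phi).
Proof. by []. Qed.

Lemma mwhl_idt (H : hom Y Z) (F : hom X Y) :
  mwhl H (tot (idt F)) = tot (idt (H ∘ F)).
Proof. by rewrite -tot_whl whl_id. Qed.

Lemma mwhr_idt (H : hom Y Z) (F : hom X Y) :
  mwhr F (tot (idt H)) = tot (idt (H ∘ F)).
Proof. by rewrite -tot_whr whr_id. Qed.

Lemma mwhl_comp (H : hom Y Z) (F G G' E : hom X Y) (psi : G' ⇒ E) (phi : F ⇒ G) :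
  G = G' ->
  mwhl H (tot psi ⊙ tot phi) = mwhl H (tot psi) ⊙ mwhl H (tot phi).
Proof.
move=> e; case: _ / e psi => psi.
by rewrite -!tot_whl -!tot_comp -!tot_whl whl_comp.
Qed.

Lemma mwhr_comp (H G G' E : hom Y Z) (F : hom X Y) (psi : G' ⇒ E) (phi : H ⇒ G) :
  G = G' ->
  mwhr F (tot psi ⊙ tot phi) = mwhr F (tot psi) ⊙ mwhr F (tot phi).
Proof.
move=> e; case: _ / e psi => psi.
by rewrite -!tot_whr -!tot_comp -!tot_whr whr_comp.
Qed.

Lemma mwhl_compE (H : hom Y Z) (F G G' E : hom X Y) (e : strict G G')
    (psi : G' ⇒ E) (phi : F ⇒ G) :
  mwhl H (tot (@compE _ _ _ _ _ e psi phi)) = mwhl H (tot psi) ⊙ mwhl H (tot phi).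
Proof. by rewrite tot_compE mwhl_comp. Qed.

Lemma mwhr_compE (H G G' E : hom Y Z) (F : hom X Y) (e : strict G G')
    (psi : G' ⇒ E) (phi : H ⇒ G) :
  mwhr F (tot (@compE _ _ _ _ _ e psi phi)) = mwhr F (tot psi) ⊙ mwhr F (tot phi).
Proof. by rewrite tot_compE mwhr_comp. Qed.

Lemma mwhl_id1 (m : mor (hom X Y)) : mwhl id1 m = m.
Proof. by case: m => [[F [F' phi]]|] //; apply/heq_tot/whl_id1. Qed.

Lemma mwhr_id1 (m : mor (hom X Y)) : mwhr id1 m = m.
Proof. by case: m => [[F [F' phi]]|] //; apply/heq_tot/whr_id1. Qed.

Lemma mwhl_mwhl (H : hom Z W) (G : hom Y Z) (m : mor (hom X Y)) :
  mwhl H (mwhl G m) = mwhl (H ∘ G) m.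
Proof. by case: m => [[F [F' phi]]|] //; apply/esym/heq_tot/whl_comp1. Qed.

Lemma mwhr_mwhr (G : hom Y Z) (F : hom X Y) (m : mor (hom Z W)) :
  mwhr F (mwhr G m) = mwhr (G ∘ F) m.
Proof. by case: m => [[H [H' phi]]|] //; apply/esym/heq_tot/whr_comp1. Qed.

Lemma mwhr_mwhl (H : hom Z W) (F : hom X Y) (m : mor (hom Y Z)) :
  mwhr F (mwhl H m) = mwhl H (mwhr F m).
Proof. by case: m => [[G [G' phi]]|] //; apply/heq_tot/whl_whr. Qed.

Lemma m_interchange (H H' : hom Y Z) (F F' : hom X Y) (psi : H ⇒ H') (phi : F ⇒ F') :
  mwhr F' (tot psi) ⊙ mwhl H (tot phi) = mwhl H' (tot phi) ⊙ mwhr F (tot psi).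
Proof. by rewrite -!tot_whl -!tot_whr -!tot_comp interchange. Qed.

End Whiskering.

Section Normalization.
Variable K : twocat.

Lemma tot_idtl (C : category) (a b b' : C) (e : strict b b') (f : a ⇒ b) :
  tot (@compE C a b b' b' e (idt b') f) = tot f.
Proof. by rewrite tot_compE mcomp_idl. Qed.

Lemma tot_idtr (C : category) (a b b' : C) (e : strict b' b) (f : b ⇒ a) :
  tot (@compE C b' b' b a e f (idt b')) = tot f.
Proof. by rewrite tot_compE mcomp_idr. Qed.

Lemma mwhlr_compE (X Y Z W : K) (L : hom Z W) (H G G' E : hom Y Z) (F : hom X Y)
    (e : strict G G') (psi : G' ⇒ E) (phi : H ⇒ G) :
  mwhl L (mwhr F (tot (@compE _ _ _ _ _ e psi phi))) =
  mwhl L (mwhr F (tot psi)) ⊙ mwhl L (mwhr F (tot phi)).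
Proof.
by rewrite mwhr_compE -!tot_whr mwhl_comp //; congr (_ ∘ _); apply: strict_eq.
Qed.

Lemma mwhl_comp0 (X Y Z : K) (H : hom Y Z) (F G E : hom X Y) (psi : G ⇒ E) (phi : F ⇒ G) :
  mwhl H (tot (comp psi phi)) = mwhl H (tot psi) ⊙ mwhl H (tot phi).
Proof. by rewrite tot_comp mwhl_comp. Qed.

Lemma mwhr_comp0 (X Y Z : K) (H G E : hom Y Z) (F : hom X Y) (psi : G ⇒ E) (phi : H ⇒ G) :
  mwhr F (tot (comp psi phi)) = mwhr F (tot psi) ⊙ mwhr F (tot phi).
Proof. by rewrite tot_comp mwhr_comp. Qed.

Lemma mwhlr_comp0 (X Y Z W : K) (L : hom Z W) (H G E : hom Y Z) (F : hom X Y)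
    (psi : G ⇒ E) (phi : H ⇒ G) :
  mwhl L (mwhr F (tot (comp psi phi))) =
  mwhl L (mwhr F (tot psi)) ⊙ mwhl L (mwhr F (tot phi)).
Proof. by rewrite mwhr_comp0 -!tot_whr mwhl_comp. Qed.

Lemma mwhl_assoc (X Y Z W V : K) (H : hom W V) (G : hom Z W) (F : hom Y Z) (m : mor (hom X Y)) :
  mwhl (H ∘ (G ∘ F)) m = mwhl (H ∘ G ∘ F) m.
Proof. by rewrite comp1_assoc. Qed.

Lemma mwhr_assoc (X Y Z W V : K) (H : hom Z W) (G : hom Y Z) (F : hom X Y) (m : mor (hom W V)) :
  mwhr (H ∘ (G ∘ F)) m = mwhr (H ∘ G ∘ F) m.
Proof. by rewrite comp1_assoc. Qed.

Lemma mwhl_1l (X Y Z : K) (H : hom Y Z) (m : mor (hom X Y)) :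
  mwhl (id1 ∘ H) m = mwhl H m.
Proof. by rewrite comp1_idl. Qed.

Lemma mwhl_1r (X Y Z : K) (H : hom Y Z) (m : mor (hom X Y)) :
  mwhl (H ∘ id1) m = mwhl H m.
Proof. by rewrite comp1_idr. Qed.

Lemma mwhr_1l (X Y Z : K) (H : hom X Y) (m : mor (hom Y Z)) :
  mwhr (id1 ∘ H) m = mwhr H m.
Proof. by rewrite comp1_idl. Qed.

Lemma mwhr_1r (X Y Z : K) (H : hom X Y) (m : mor (hom Y Z)) :
  mwhr (H ∘ id1) m = mwhr H m.
Proof. by rewrite comp1_idr. Qed.

End Normalization.

(* Rewrites [tot] of a pasting diagram into a left-associated [⊙]-composite of
   atoms [mwhl H (mwhr F (tot x))]. *)
Definition mnorm := (tot_idtl, tot_idtr, tot_whl, tot_whr, mwhl_mwhl, mwhr_mwhr,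
  mwhr_mwhl, mwhl_id1, mwhr_id1, mwhl_assoc, mwhr_assoc,
  (mwhl_1l, mwhl_1r, mwhr_1l, mwhr_1r),
  (mwhlr_compE, mwhlr_comp0, mwhl_compE, mwhl_comp0, mwhr_compE, mwhr_comp0,
   mwhl_idt, mwhr_idt), (tot_compE, tot_comp), mcompA).

Lemma eq_heq (C : category) (a b : C) (f g : a ⇒ b) : f = g -> f ≈ g.
Proof. by move->. Qed.

Lemma whl_eq (K : twocat) (X Y Z : K) (H : hom Y Z) (F F' E E' : hom X Y)
  (phi : F ⇒ F') (psi : E ⇒ E') : phi ≈ psi -> tot (H ◁ phi) = tot (H ◁ psi).
Proof. by case. Qed.

Lemma whr_eq (K : twocat) (X Y Z : K) (F : hom X Y) (H H' E E' : hom Y Z)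
  (phi : H ⇒ H') (psi : E ⇒ E') : phi ≈ psi -> tot (phi ▷ F) = tot (psi ▷ F).
Proof. by case. Qed.

Section TangentCalculus.
Variables (K : twocat) (X X' X'' : tangentad K).
Local Notation D := (tdata (tstr X)).
Local Notation D' := (tdata (tstr X')).
Local Notation D'' := (tdata (tstr X'')).
Local Notation T := (tT D).
Local Notation T' := (tT D').
Local Notation T'' := (tT D'').

Lemma mor_rewrite (C : category) (a b c : mor C) : a ⊙ b = c ->
  forall r, r ⊙ a ⊙ b = r ⊙ c.
Proof. by move=> <- r; rewrite mcompA. Qed.

Lemma mor_rewrite2 (C : category) (a b c d : mor C) : a ⊙ b ⊙ c = d ->
  forall r, r ⊙ a ⊙ b ⊙ c = r ⊙ d.
Proof. by move=> <- r; rewrite !mcompA. Qed.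

Section Comp.
Variables (F : lax_mor X X') (G : lax_mor X' X'').
Local Notation "'α'" := (dist F).
Local Notation "'β'" := (dist G).

Definition comp_dist : (mor1 G ∘ mor1 F) ∘ T ⇒ T'' ∘ (mor1 G ∘ mor1 F) :=
  idt (T'' ∘ (mor1 G ∘ mor1 F)) • ((β ▷ mor1 F) • (mor1 G ◁ α))
    • idt ((mor1 G ∘ mor1 F) ∘ T).

Lemma tot_comp_dist : tot comp_dist = mwhr (mor1 F) (tot β) ⊙ mwhl (mor1 G) (tot α).
Proof. by rewrite /comp_dist !mnorm. Qed.

Lemma mwhl_comp_dist (Y : K) (H : hom X'' Y) :
  mwhl H (tot comp_dist) =
  mwhl H (mwhr (mor1 F) (tot β)) ⊙ mwhl (H ∘ mor1 G) (tot α).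
Proof. by rewrite tot_comp_dist -tot_whr -tot_whl mwhl_comp ?comp1_assoc // !mnorm. Qed.

Lemma mwhr_comp_dist (Y : K) (H : hom Y X) :
  mwhr H (tot comp_dist) =
  mwhr (mor1 F ∘ H) (tot β) ⊙ mwhl (mor1 G) (mwhr H (tot α)).
Proof. by rewrite tot_comp_dist -tot_whr -tot_whl mwhr_comp ?comp1_assoc // !mnorm. Qed.

Definition cnorm := (tot_whl, tot_whr, mwhl_comp_dist, mwhr_comp_dist, tot_comp_dist, mnorm).

Lemma comp_lax : is_lax comp_dist.
Proof.
case: (lax_ax F) (lax_ax G) => [Fp Fz [u [Fu1 Fu2] Fs] Fl Fc] [Gp Gz [v [Gv1 Gv2] Gs] Gl Gc].
have XC := m_interchange β α; rewrite ?mnorm in XC.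
split.
- apply/heq_tot; rewrite !cnorm.
  have := whr_eq (mor1 F) Gp; rewrite !mnorm => ->.
  by have := whl_eq (mor1 G) Fp; rewrite !mnorm => ->.
- apply/heq_tot; rewrite !cnorm.
  have := whl_eq (mor1 G) Fz; rewrite !mnorm => /mor_rewrite->.
  by have := whr_eq (mor1 F) Gz; rewrite !mnorm => ->.
- exists (idt (Tn D'' 2 ∘ (mor1 G ∘ mor1 F)) • ((v ▷ mor1 F) • (mor1 G ◁ u))
            • idt ((mor1 G ∘ mor1 F) ∘ Tn D 2)).
  + split; apply: tot_inj; rewrite !cnorm.
    * have := whr_eq (mor1 F) (eq_heq Gv1); rewrite !mnorm => ->.
      by have := whl_eq (mor1 G) (eq_heq Fu1); rewrite !mnorm => /mor_rewrite->; rewrite !mnorm.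
    * have := whr_eq (mor1 F) (eq_heq Gv2); rewrite !mnorm => ->.
      by have := whl_eq (mor1 G) (eq_heq Fu2); rewrite !mnorm => /mor_rewrite->; rewrite !mnorm.
  + apply/heq_tot; rewrite !cnorm.
    have := whl_eq (mor1 G) Fs; rewrite !mnorm => /mor_rewrite->; rewrite !mnorm.
    by have := whr_eq (mor1 F) Gs; rewrite !mnorm => ->.
- apply/heq_tot; rewrite !cnorm.
  rewrite !(mor_rewrite (esym XC)) !mnorm.
  have := whr_eq (mor1 F) Gl; rewrite !mnorm => ->.
  by have := whl_eq (mor1 G) Fl; rewrite !mnorm => /mor_rewrite->; rewrite !mnorm.
- apply/heq_tot; rewrite !cnorm.
  rewrite !(mor_rewrite (esym XC)) !mnorm.
  have := whr_eq (mor1 F) Gc; rewrite !mnorm => ->.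
  by have := whl_eq (mor1 G) Fc; rewrite !mnorm => /mor_rewrite2->; rewrite !mnorm.
Qed.

End Comp.
End TangentCalculus.
Section IdLax.
Variables (K : twocat) (X : tangentad K).
Local Notation D := (tdata (tstr X)).

Definition id_dist : id1 ∘ tT D ⇒ tT D ∘ id1 :=
  idt (tT D ∘ id1) • idt (id1 ∘ tT D).

Lemma tot_id_dist : tot id_dist = tot (idt (tT D)).
Proof. by rewrite /id_dist tot_idtr comp1_idr. Qed.

Lemma mwhl_id_dist (Y : K) (H : hom X Y) :
  mwhl H (tot id_dist) = tot (idt (H ∘ tT D)).
Proof. by rewrite tot_id_dist mwhl_idt. Qed.

Lemma mwhr_id_dist (Y : K) (H : hom Y X) :
  mwhr H (tot id_dist) = tot (idt (tT D ∘ H)).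
Proof. by rewrite tot_id_dist mwhr_idt. Qed.

Lemma id_lax : is_lax id_dist.
Proof.
have idn := (tot_whl, tot_whr, mwhl_id1, mwhr_id1, mwhl_id_dist, mwhr_id_dist,
             tot_id_dist, tot_compE, tot_comp).
split.
- by apply/heq_tot; rewrite !idn mcomp_idr.
- by apply/heq_tot; rewrite !idn mcomp_idl.
- have e : tot (idt (Tn D 2 ∘ id1) • idt (id1 ∘ Tn D 2)) = tot (idt (Tn D 2)).
    by rewrite tot_idtl comp1_idl.
  exists (idt (Tn D 2 ∘ id1) • idt (id1 ∘ Tn D 2)).
  + by split; apply: tot_inj; rewrite tot_comp e !idn mcomp_idr // mcomp_idl.
  + by apply/heq_tot; rewrite [in RHS]tot_compE e !idn mcomp_idr // mcomp_idl.
- by apply/heq_tot; rewrite !idn mcomp_idr // !mcomp_idl.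
- by apply/heq_tot; rewrite !idn !mcomp_idr // !mcomp_idl.
Qed.

End IdLax.

Section Tng.
Variable K : twocat.

Lemma lax_mor_eq (X X' : tangentad K) (F G : lax_mor X X') :
  mor1 F = mor1 G -> dist F ≈ dist G -> F = G.
Proof.
case: F G => F a Fa [G b Gb] /= e; case: _ / e b Gb => b Gb /heq_eq e.
by case: _ / e Gb => Gb; rewrite (proof_irrelevance _ Fa Gb).
Qed.

Section Hom.
Variables X X' : tangentad K.
Local Notation T := (tT (tdata (tstr X))).
Local Notation T' := (tT (tdata (tstr X'))).

Lemma tangent2_eq (F G : lax_mor X X') (phi psi : tangent2 F G) :
  cell2 phi = cell2 psi -> phi = psi.
Proof.
case: phi psi => phi Hphi [psi Hpsi] /= e; case: _ / e Hpsi => Hpsi.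
by rewrite (proof_irrelevance _ Hphi Hpsi).
Qed.

Lemma id_tangent2 (F : lax_mor X X') : is_tangent2 F F (idt (mor1 F)).
Proof. by apply/heq_tot; rewrite !mnorm mcomp_idl // mcomp_idr. Qed.

Lemma comp_tangent2 (F G H : lax_mor X X') (psi : tangent2 G H) (phi : tangent2 F G) :
  is_tangent2 F H (comp psi phi).
Proof.
apply/heq_tot; rewrite !mnorm.
move/heq_tot: (tangent2_ax phi); rewrite !mnorm => /mor_rewrite->; rewrite !mnorm.
by move/heq_tot: (tangent2_ax psi); rewrite !mnorm => ->.
Qed.

Definition tng_hom : category := {|
  obj := lax_mor X X';
  arr := @tangent2 K X X';
  idt := fun F => Tangent2 (id_tangent2 F);
  comp := fun F G H psi phi => Tangent2 (comp_tangent2 psi phi);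
  comp1l := fun F G phi => tangent2_eq (comp1l (cell2 phi) : cell2 (Tangent2 _) = _);
  comp1r := fun F G phi => tangent2_eq (comp1r (cell2 phi) : cell2 (Tangent2 _) = _);
  compA := fun F G H I h g f =>
    tangent2_eq (compA (cell2 h) (cell2 g) (cell2 f) :
                 cell2 (Tangent2 _) = cell2 (Tangent2 _)) |}.

End Hom.

Lemma tng_heq (X X' : tangentad K) (F G F' G' : tng_hom X X') (phi : F ⇒ G) (psi : F' ⇒ G') :
  F = F' -> G = G' -> cell2 phi ≈ cell2 psi -> phi ≈ psi.
Proof.
move=> eF eG; case: _ / eF psi => psi; case: _ / eG psi => psi.
by move/heq_eq/tangent2_eq->.
Qed.

Definition tng_id (X : tangentad K) : lax_mor X X := LaxMor (id_lax X).

Definition tng_comp (X X' X'' : tangentad K) (G : lax_mor X' X'') (F : lax_mor X X') :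
  lax_mor X X'' := LaxMor (comp_lax F G).

Lemma tng_whl_ax (X X' X'' : tangentad K) (G : lax_mor X' X'') (F F' : lax_mor X X')
    (phi : tangent2 F F') : is_tangent2 (tng_comp G F) (tng_comp G F') (mor1 G ◁ phi).
Proof.
apply/heq_tot; rewrite tot_compE [in RHS]tot_compE !cnorm.
have := m_interchange (dist G) (cell2 phi); rewrite ?mnorm => <-.
have := whl_eq (mor1 G) (tangent2_ax phi); rewrite !mnorm => /mor_rewrite->.
by rewrite !mnorm.
Qed.

Lemma tng_whr_ax (X X' X'' : tangentad K) (G G' : lax_mor X' X'') (F : lax_mor X X')
    (phi : tangent2 G G') : is_tangent2 (tng_comp G F) (tng_comp G' F) (phi ▷ mor1 F).
Proof.
apply/heq_tot; rewrite tot_compE [in RHS]tot_compE !cnorm.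
have := whr_eq (mor1 F) (tangent2_ax phi); rewrite !mnorm => ->.
have := m_interchange (cell2 phi) (dist F); rewrite ?mnorm => /mor_rewrite->.
by rewrite !mnorm.
Qed.

Lemma tng_idl (X X' : tangentad K) (F : lax_mor X X') : tng_comp (tng_id X') F = F.
Proof.
apply: lax_mor_eq; first exact: comp1_idl.
apply/heq_tot; rewrite tot_comp_dist mwhr_id_dist mwhl_id1.
by rewrite mcomp_idl.
Qed.

Lemma tng_idr (X X' : tangentad K) (F : lax_mor X X') : tng_comp F (tng_id X) = F.
Proof.
apply: lax_mor_eq; first exact: comp1_idr.
apply/heq_tot; rewrite tot_comp_dist mwhl_id_dist mwhr_id1.
by rewrite mcomp_idr.
Qed.

Lemma tng_assoc (X Y Z W : tangentad K) (H : lax_mor Z W) (G : lax_mor Y Z) (F : lax_mor X Y) :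
  tng_comp H (tng_comp G F) = tng_comp (tng_comp H G) F.
Proof.
apply: lax_mor_eq; first exact: comp1_assoc.
apply/heq_tot.
rewrite (tot_comp_dist (tng_comp G F) H) (tot_comp_dist F (tng_comp H G)).
by rewrite (mwhl_comp_dist F G) (mwhr_comp_dist G H) mcompA.
Qed.

Definition tng_whl (X Y Z : tangentad K) (H : tng_hom Y Z) (F F' : tng_hom X Y) (phi : F ⇒ F') :
  @arr (tng_hom X Z) (tng_comp H F) (tng_comp H F') := Tangent2 (tng_whl_ax H phi).
Definition tng_whr (X Y Z : tangentad K) (H H' : tng_hom Y Z) (F : tng_hom X Y) (phi : H ⇒ H') :
  @arr (tng_hom X Z) (tng_comp H F) (tng_comp H' F) := Tangent2 (tng_whr_ax F phi).

Definition Tng : twocat.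
Proof.
refine (@TwoCat (tangentad K) tng_hom tng_id tng_comp tng_whl tng_whr
  tng_idl tng_idr tng_assoc _ _ _ _ _ _ _ _ _ _).
- by move=> X Y Z H F; apply: tangent2_eq; apply: whl_id.
- by move=> X Y Z H F F' F'' psi phi; apply: tangent2_eq; apply: whl_comp.
- by move=> X Y Z H F; apply: tangent2_eq; apply: whr_id.
- by move=> X Y Z H H' H'' F psi phi; apply: tangent2_eq; apply: whr_comp.
- by move=> X Y F F' phi; apply: tng_heq; [exact: tng_idl..|exact: whl_id1].
- by move=> X Y F F' phi; apply: tng_heq; [exact: tng_idr..|exact: whr_id1].
- by move=> X Y Z W H G F F' phi; apply: tng_heq; [exact/esym/tng_assoc..|exact: whl_comp1].
- by move=> X Y Z W H H' G F phi; apply: tng_heq; [exact: tng_assoc..|exact: whr_comp1].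
- by move=> X Y Z W H G G' F phi; apply: tng_heq; [exact/esym/tng_assoc..|exact: whl_whr].
- by move=> X Y Z H H' F F' psi phi; apply: tangent2_eq; apply: interchange.
Defined.

End Tng.
Section Iso.
Variable C : category.

Lemma inv_idt (a : C) : is_invertible (idt a).
Proof. by exists (idt a); rewrite comp1l. Qed.

Lemma inv_compE (a b b' c : C) (e : strict b b') (g : b' ⇒ c) (f : a ⇒ b) :
  is_invertible g -> is_invertible f -> is_invertible (g • f).
Proof.
case: _ / e g => g [g' [g1 g2]] [f' [f1 f2]]; rewrite compE_comp.
exists (comp f' g'); split.
- by rewrite compA -[comp (comp f' _) _]compA g1 comp1r.
- by rewrite compA -[comp (comp g _) _]compA f2 comp1r.
Qed.

Lemma nfold_iso (a b a' b' P P' : C) (p : a ⇒ b) (p' : a' ⇒ b') n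
    (pi : 'I_n -> (P ⇒ a)) (pi' : 'I_n -> (P' ⇒ a'))
    (ea : a' ⇒ a) (eb : b' ⇒ b) (eP : P' ⇒ P) :
  is_invertible ea -> is_invertible eb -> is_invertible eP ->
  comp p ea = comp eb p' -> (forall i, comp (pi i) eP = comp ea (pi' i)) ->
  is_nfold_pullback p pi -> is_nfold_pullback p' pi'.
Proof.
move=> [da [a1 a2]] [db [b1 b2]] [dP [P1 P2]] Ep Epi [cone univ]; split.
  suff E i : comp p' (pi' i) = comp db (comp (comp p (pi i)) eP).
    by move=> i j; rewrite !E (cone i j).
  by rewrite -compA Epi [comp p _]compA Ep -!compA [RHS]compA b1 comp1l.
move=> Q q Hq; case: (univ Q (fun i => comp ea (q i))) => [i j|u [Hu uniq]].
  by rewrite !compA Ep -!compA (Hq i j).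
exists (comp dP u); split=> [i | v Hv].
  rewrite -[LHS]comp1l -[RHS]comp1l -a1 -!compA; congr (comp da _).
  by rewrite compA -Epi -compA [comp eP _]compA P2 comp1l Hu.
rewrite (uniq (comp eP v)); first by rewrite compA P1 comp1l.
by move=> i; rewrite compA Epi -compA Hv.
Qed.

Lemma nfold_unique (a b P P' : C) (p : a ⇒ b) n
    (pi : 'I_n -> (P ⇒ a)) (pi' : 'I_n -> (P' ⇒ a)) :
  is_nfold_pullback p pi -> is_nfold_pullback p pi' ->
  exists2 e : P ⇒ P', is_invertible e & forall i, comp (pi' i) e = pi i.
Proof.
move=> [c1 u1] [c2 u2].
have [e [He _]] := u2 _ _ c1; have [d [Hd _]] := u1 _ _ c2.
exists e => //; exists d; split.
- have [w [_ uw]] := u1 _ _ c1.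
  rewrite -(uw (idt P)) => [|i]; last by rewrite comp1r.
  by symmetry; apply: uw => i; rewrite compA Hd He.
- have [w [_ uw]] := u2 _ _ c2.
  rewrite -(uw (idt P')) => [|i]; last by rewrite comp1r.
  by symmetry; apply: uw => i; rewrite compA He Hd.
Qed.

Lemma pullback_iso (P a b c P' a' b' c' : C)
    (f : P ⇒ a) (g : P ⇒ b) (h : a ⇒ c) (k : b ⇒ c)
    (f' : P' ⇒ a') (g' : P' ⇒ b') (h' : a' ⇒ c') (k' : b' ⇒ c')
    (eP : P' ⇒ P) (ea : a' ⇒ a) (eb : b' ⇒ b) (ec : c' ⇒ c) :
  is_invertible eP -> is_invertible ea -> is_invertible eb -> is_invertible ec ->
  comp f eP = comp ea f' -> comp g eP = comp eb g' ->
  comp h ea = comp ec h' -> comp k eb = comp ec k' ->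
  is_pullback f g h k -> is_pullback f' g' h' k'.
Proof.
move=> [dP [P1 P2]] [da [a1 a2]] [db [b1 b2]] [dc [c1 c2]] Ef Eg Eh Ek [sq univ].
have ecK d (x y : d ⇒ c') : comp ec x = comp ec y -> x = y.
  by move=> E; rewrite -[x]comp1l -[y]comp1l -c1 -!compA E.
have eaK d (x y : d ⇒ a') : comp ea x = comp ea y -> x = y.
  by move=> E; rewrite -[x]comp1l -[y]comp1l -a1 -!compA E.
have ebK d (x y : d ⇒ b') : comp eb x = comp eb y -> x = y.
  by move=> E; rewrite -[x]comp1l -[y]comp1l -b1 -!compA E.
split.
  by apply: ecK; rewrite !compA -Eh -Ek -!compA -Ef -Eg !compA sq.
move=> Q x y Hxy; case: (univ Q (comp ea x) (comp eb y)) => [|u [[Hu1 Hu2] uniq]].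
  by rewrite !compA Eh Ek -!compA Hxy.
exists (comp dP u); split=> [|v [V1 V2]].
  by split; [apply: eaK | apply: ebK]; rewrite compA -?Ef -?Eg -compA [comp eP _]compA P2 comp1l.
rewrite (uniq (comp eP v)); first by rewrite compA P1 comp1l.
by rewrite !compA Ef Eg -!compA V1 V2.
Qed.

End Iso.

Lemma inv_fmap (C D : category) (Phi : functor C D) (a b : C) (f : a ⇒ b) :
  is_invertible f -> is_invertible (fmap Phi f).
Proof.
by case=> g [g1 g2]; exists (fmap Phi g); rewrite -!fmap_comp g1 g2 !fmap_id.
Qed.

Section PointwiseIso.
Variables (K : twocat) (X Y : K).

Lemma pw_nfold_iso (a b a' b' P P' : hom X Y) (p : a ⇒ b) (p' : a' ⇒ b') n
    (pi : 'I_n -> (P ⇒ a)) (pi' : 'I_n -> (P' ⇒ a'))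
    (ea : a' ⇒ a) (eb : b' ⇒ b) (eP : P' ⇒ P) :
  is_invertible ea -> is_invertible eb -> is_invertible eP ->
  comp p ea = comp eb p' -> (forall i, comp (pi i) eP = comp ea (pi' i)) ->
  pointwise_nfold_pullback p pi -> pointwise_nfold_pullback p' pi'.
Proof.
move=> ia ib iP Ep Epi [H Hpw]; split; first exact: (nfold_iso ia ib iP Ep Epi H).
move=> Z F; pose Phi := precomp Y F.
apply: (nfold_iso (inv_fmap Phi ia) (inv_fmap Phi ib) (inv_fmap Phi iP) _ _ (Hpw Z F)).
- by rewrite -!fmap_comp Ep.
- by move=> i; rewrite -!fmap_comp Epi.
Qed.

Lemma pw_pullback_iso (P a b c P' a' b' c' : hom X Y)
    (f : P ⇒ a) (g : P ⇒ b) (h : a ⇒ c) (k : b ⇒ c)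
    (f' : P' ⇒ a') (g' : P' ⇒ b') (h' : a' ⇒ c') (k' : b' ⇒ c')
    (eP : P' ⇒ P) (ea : a' ⇒ a) (eb : b' ⇒ b) (ec : c' ⇒ c) :
  is_invertible eP -> is_invertible ea -> is_invertible eb -> is_invertible ec ->
  comp f eP = comp ea f' -> comp g eP = comp eb g' ->
  comp h ea = comp ec h' -> comp k eb = comp ec k' ->
  pointwise_pullback f g h k -> pointwise_pullback f' g' h' k'.
Proof.
move=> iP ia ib ic Ef Eg Eh Ek [H Hpw].
split; first exact: pullback_iso iP ia ib ic Ef Eg Eh Ek H.
move=> Z F; pose Phi := precomp Y F.
apply: (pullback_iso (inv_fmap Phi iP) (inv_fmap Phi ia) (inv_fmap Phi ib)
  (inv_fmap Phi ic) _ _ _ _ (Hpw Z F)); by rewrite -!fmap_comp ?Ef ?Eg ?Eh ?Ek.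
Qed.

Variables (Z : K) (F : hom Z X).

Let cast (Z' : K) (E : hom Z' Z) (H : hom X Y) : H ∘ F ∘ E ⇒ H ∘ (F ∘ E) :=
  idt (H ∘ (F ∘ E)) • idt (H ∘ F ∘ E).
Let inv_cast (Z' : K) (E : hom Z' Z) H : is_invertible (cast E H).
Proof. exact: inv_compE (inv_idt _) (inv_idt _). Qed.
Let cast_nat (Z' : K) (E : hom Z' Z) (H H' : hom X Y) (phi : H ⇒ H') :
  comp (phi ▷ (F ∘ E)) (cast E H) = comp (cast E H') (phi ▷ F ▷ E).
Proof.
have ec H0 : tot (cast E H0) = tot (idt (H0 ∘ (F ∘ E))) by rewrite /cast tot_idtr.
by apply: tot_inj; rewrite (tot_comp (phi ▷ _)) (tot_comp (cast E H')) !ec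
  mcomp_idr // mcomp_idl ?comp1_assoc // !mnorm.
Qed.

Lemma pw_nfold_whr (a b P : hom X Y) (p : a ⇒ b) n (pi : 'I_n -> (P ⇒ a)) :
  pointwise_nfold_pullback p pi ->
  pointwise_nfold_pullback (p ▷ F) (fun i => pi i ▷ F).
Proof.
move=> [_ Hpw]; split; first exact: Hpw.
move=> Z' E; apply: nfold_iso (inv_cast E a) (inv_cast E b) (inv_cast E P) _ _ (Hpw Z' (F ∘ E)).
- exact: cast_nat.
- by move=> i; apply: cast_nat.
Qed.

Lemma pw_pullback_whr (P a b c : hom X Y)
    (f : P ⇒ a) (g : P ⇒ b) (h : a ⇒ c) (k : b ⇒ c) :
  pointwise_pullback f g h k ->
  pointwise_pullback (f ▷ F) (g ▷ F) (h ▷ F) (k ▷ F).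
Proof.
move=> [_ Hpw]; split; first exact: Hpw.
by move=> Z' E; apply: (pullback_iso (inv_cast E P) (inv_cast E a) (inv_cast E b)
  (inv_cast E c) _ _ _ _ (Hpw Z' (F ∘ E))); apply: cast_nat.
Qed.

End PointwiseIso.

Section Strong.
Variable K : twocat.

Section Monic.
Variable X : tangentad K.
Local Notation D := (tdata (tstr X)).

Lemma tot_Tp : tot (Tp D) = mwhl (tT D) (tot (tp D)).
Proof. by rewrite /Tp tot_idtl. Qed.

Lemma T_Tn_pullback n : 0 < n ->
  pointwise_nfold_pullback (tT D ◁ tp D) (fun k => tT D ◁ tpi D n k).
Proof.
move=> n0; have [_ /(_ 1)] := ax_Tn (tax (tstr X)) n0.
by move: (comp1_idr (tT D) : iter1 (tT D) 1 = tT D); move: (iter1 _ 1) => H ->.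
Qed.

Lemma pair_monic (C : category) (P a b Q : C) (p : a ⇒ b) (pi : 'I_2 -> (P ⇒ a))
    (u v : Q ⇒ P) : is_nfold_pullback p pi ->
  comp (pi ord0) u = comp (pi ord0) v ->
  comp (pi ord_max) u = comp (pi ord_max) v -> u = v.
Proof.
move=> [cone univ] E0 E1.
have [i j|w [_ uw]] := univ Q (fun i => comp (pi i) u).
  by rewrite !compA (cone i j).
rewrite -(uw u) //; apply: uw => i.
suff [-> //|-> //] : i = ord0 \/ i = ord_max.
by case: i => [[|[|//]] Hi]; [left | right]; apply: val_inj.
Qed.

Lemma is_vlift_uniq (mu mu' : Tn D 2 ⇒ tT D ∘ tT D) : is_vlift mu -> is_vlift mu' -> mu = mu'.
Proof.
move=> [u [u1 u2] ->] [v [v1 v2] ->]; congr (_ • _).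
have [pb _] := T_Tn_pullback (isT : 0 < 2).
by apply: (pair_monic pb); rewrite /= ?[LHS]u1 ?[LHS]u2.
Qed.

End Monic.

Lemma id_strong (X : tangentad K) : is_strong (tng_id X).
Proof. exact: inv_compE (inv_idt _) (inv_idt _). Qed.

Lemma comp_strong (X X' X'' : tangentad K) (G : lax_mor X' X'') (F : lax_mor X X') :
  is_strong G -> is_strong F -> is_strong (tng_comp G F).
Proof.
move=> sG sF; apply: inv_compE (inv_idt _); apply: inv_compE (inv_idt _) _.
apply: inv_compE; first exact: (@inv_fmap _ _ (precomp _ (mor1 F))).
exact: (@inv_fmap _ _ (postcomp _ (mor1 G))).
Qed.

Lemma preserves_ftl_id (X : tangentad K) : preserves_ftl (X := X) (X' := X) id1.
Proof.
pose cast (H : hom X X) : id1 ∘ H ⇒ H :=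
  @compE _ _ _ _ _ (comp1_idl H) (idt H) (idt (id1 ∘ H)).
have inv_cast H : is_invertible (cast H) by exact: inv_compE (inv_idt _) (inv_idt _).
have cast_nat (H H' : hom X X) (phi : H ⇒ H') :
    comp phi (cast H) = comp (cast H') (id1 ◁ phi).
  have ec H0 : tot (cast H0) = tot (idt H0) by rewrite /cast tot_idtl comp1_idl.
  by apply: tot_inj; rewrite (tot_comp phi) (tot_comp (cast H')) !ec
    mcomp_idr // mcomp_idl ?comp1_idl // !mnorm.
split=> [n n0|mu Hmu].
- have [Tpw _] := ax_Tn (tax (tstr X)) n0.
  by apply: pw_nfold_iso (inv_cast _) (inv_cast _) (inv_cast _) _ _ Tpw => *; apply: cast_nat.
- have [mu' Hmu' pb] := ax_vlift (tax (tstr X)).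
  have -> : mu = mu'.
    exact: is_vlift_uniq.
  by apply: pw_pullback_iso (inv_cast _) (inv_cast _) (inv_cast _) (inv_cast _) _ _ _ _ pb;
    apply: cast_nat.
Qed.

Section CompPreserves.
Variables (X X' X'' : tangentad K) (F : lax_mor X X') (G : lax_mor X' X'').
Local Notation D := (tdata (tstr X)).
Local Notation D' := (tdata (tstr X')).
Local Notation T := (tT D).
Local Notation T' := (tT D').
Local Notation f := (mor1 F).
Local Notation g := (mor1 G).
Hypotheses (sF : is_strong F) (pF : preserves_ftl f) (pG : preserves_ftl g).

Let lift (A : hom X X) (A' : hom X' X') (x : f ∘ A ⇒ A' ∘ f) :
    (g ∘ f) ∘ A ⇒ (g ∘ A') ∘ f :=
  idt ((g ∘ A') ∘ f) • (g ◁ x) • idt ((g ∘ f) ∘ A).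

Let inv_lift A A' (x : f ∘ A ⇒ A' ∘ f) : is_invertible x -> is_invertible (lift x).
Proof.
move=> ix; apply: inv_compE (inv_idt _); apply: inv_compE (inv_idt _) _.
exact: (@inv_fmap _ _ (postcomp _ g)).
Qed.

Let lift_nat A A' B B' (x : f ∘ A ⇒ A' ∘ f) (y : f ∘ B ⇒ B' ∘ f)
    (m : A ⇒ B) (m' : A' ⇒ B') :
  comp (m' ▷ f) x = comp y (f ◁ m) ->
  comp (g ◁ m' ▷ f) (lift x) = comp (lift y) (g ∘ f ◁ m).
Proof.
move=> E; apply: tot_inj; rewrite !mnorm.
by have := whl_eq g (eq_heq E); rewrite !mnorm.
Qed.

Let id_sw : f ∘ id1 ⇒ id1 ∘ f := idt (id1 ∘ f) • idt (f ∘ id1).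
Let tot_id_sw : tot id_sw = tot (idt f).
Proof. by rewrite /id_sw tot_idtr comp1_idl. Qed.

Let id_sw_p : comp (tp D' ▷ f) (dist F) = comp id_sw (f ◁ tp D).
Proof.
apply: tot_inj; rewrite [RHS]tot_comp tot_id_sw mcomp_idl ?comp1_idr //.
by have /heq_tot <- := lax_p (lax_ax F); rewrite [RHS]tot_compE [LHS]tot_comp.
Qed.

Lemma Tn_comparison n : 0 < n ->
  exists2 e : f ∘ Tn D n ⇒ Tn D' n ∘ f, is_invertible e &
    forall i, comp (tpi D' n i ▷ f) e = comp (dist F) (f ◁ tpi D n i).
Proof.
move=> n0; have [pb _] := (pF.1 n n0).
have [/(pw_nfold_whr f) [pb' _] _] := ax_Tn (tax (tstr X')) n0.
case: (sF) => d [d1 d2].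
have inv_sw : is_invertible id_sw by exact: inv_compE (inv_idt _) (inv_idt _).
have H := nfold_iso (pi' := fun i => comp d (tpi D' n i ▷ f)) sF inv_sw (inv_idt _)
  id_sw_p _ pb'.
have [|e ie Ee] := nfold_unique pb (H _).
  by move=> i; rewrite comp1r compA d2 comp1l.
exists e => // i; rewrite -[f ◁ _](Ee i) -compA [RHS]compA d2 comp1l.
by [].
Qed.

Let t : f ∘ (T ∘ T) ⇒ (T' ∘ T') ∘ f :=
  idt (T' ∘ T' ∘ f) • ((T' ◁ dist F) • (dist F ▷ T)) • idt (f ∘ (T ∘ T)).

Let tot_t : tot t = mwhl T' (tot (dist F)) ⊙ mwhr T (tot (dist F)).
Proof. by rewrite /t !mnorm. Qed.

Let inv_t : is_invertible t.
Proof.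
apply: inv_compE (inv_idt _); apply: inv_compE (inv_idt _) _.
by apply: inv_compE; [apply: (@inv_fmap _ _ (postcomp _ T')) | apply: (@inv_fmap _ _ (precomp _ T))].
Qed.

Lemma vlift_comparison (mu : Tn D 2 ⇒ T ∘ T) (mu' : Tn D' 2 ⇒ T' ∘ T')
    (e : f ∘ Tn D 2 ⇒ Tn D' 2 ∘ f) :
  is_vlift mu -> is_vlift mu' ->
  (forall i, comp (tpi D' 2 i ▷ f) e = comp (dist F) (f ◁ tpi D 2 i)) ->
  comp (mu' ▷ f) e = comp t (f ◁ mu).
Proof.
move=> [u [u1 u2] ->] [u' [u1' u2'] ->] Ee.
have [_ _ [v [v1 v2] Es] El _] := lax_ax F.
have ev : v = e.
  have [_ /(_ _ f) pb] := (ax_Tn (tax (tstr X')) (isT : 0 < 2)).1.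
  by apply: (pair_monic pb); [rewrite [LHS]v1 | rewrite [LHS]v2]; rewrite [RHS]Ee compE_comp.
subst v.
have ax i (w := tpi D 2 i) (w' := tpi D' 2 i) :
    mwhr f (tot w') ⊙ tot e = tot (dist F) ⊙ mwhl f (tot w).
  by have := congr1 (@tot _ _ _) (Ee i); rewrite !mnorm.
have Te i (w := tpi D 2 i) (w' := tpi D' 2 i) :
    mwhl T' (mwhr f (tot w')) ⊙ mwhl T' (tot e) ⊙ mwhr (Tn D 2) (tot (dist F)) =
    mwhl T' (tot (dist F)) ⊙ mwhr T (tot (dist F)) ⊙ mwhl (f ∘ T) (tot w).
  have := whl_eq T' (eq_heq (Ee i)); rewrite !mnorm => ->.
  have := m_interchange (dist F) (tpi D 2 i); rewrite ?mnorm => /esym /mor_rewrite->.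
  by rewrite mcompA.
have [L tot_L] : exists L : f ∘ Tn D 2 ⇒ (T' ∘ Tn D' 2) ∘ f,
    tot L = mwhl T' (tot e) ⊙ mwhr (Tn D 2) (tot (dist F)) ⊙ mwhl f (tot u).
  exists (idt ((T' ∘ Tn D' 2) ∘ f) • ((T' ◁ e) • (dist F ▷ Tn D 2) • (f ◁ u))).
  by rewrite !mnorm.
have key : L = comp (u' ▷ f) e.
  have [_ /(_ _ f) pb] := T_Tn_pullback X' (isT : 0 < 2).
  apply: (pair_monic pb); apply: tot_inj;
    rewrite [LHS]tot_comp [RHS]tot_comp tot_L !mnorm Te.
  - have := whl_eq f (eq_heq u1); rewrite !mnorm => /mor_rewrite->; rewrite !mnorm.
    have := whr_eq f (eq_heq u1'); rewrite !mnorm => ->.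
    rewrite (mor_rewrite (ax ord0)) !mnorm; congr (_ ⊙ _).
    by have /heq_tot := El; rewrite !mnorm => ->.
  - have := whl_eq f (eq_heq u2); rewrite !mnorm => /mor_rewrite->; rewrite !mnorm.
    have := whr_eq f (eq_heq u2'); rewrite !mnorm => ->.
    rewrite (mor_rewrite (ax ord_max)) !mnorm; congr (_ ⊙ _).
    have := whr_eq T (lax_z (lax_ax F)); rewrite !mnorm => /mor_rewrite->.
    by have := m_interchange (tz D') (dist F); rewrite !mnorm => ->.
apply: tot_inj; rewrite [RHS]tot_comp tot_t !mnorm.
have /(congr1 (@tot _ _ _)) := key; rewrite tot_L !mnorm => /esym/mor_rewrite->.
rewrite !mcompA; have := whl_eq T' Es; rewrite !mnorm => <-.
by have := m_interchange (dist F) (ts D); rewrite ?mnorm => /esym /mor_rewrite->; rewrite !mcompA.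
Qed.

Lemma preserves_ftl_comp : preserves_ftl (X := X) (X' := X'') (g ∘ f).
Proof.
split=> [n n0|mu Hmu].
- have [e ie Ee] := Tn_comparison n0.
  apply: (pw_nfold_iso (inv_lift sF) (inv_lift (x := id_sw) _) (inv_lift ie) _ _
    (pw_nfold_whr f (pG.1 n n0))).
  + exact: inv_compE (inv_idt _) (inv_idt _).
  + by apply: lift_nat; apply: id_sw_p.
  + by move=> i; apply: lift_nat; apply: Ee.
- have [mu' Hmu' _] := ax_vlift (tax (tstr X')).
  have [e ie Ee] := Tn_comparison (isT : 0 < 2).
  apply: (pw_pullback_iso (inv_lift ie) (inv_lift inv_t) (inv_lift (x := id_sw) _)
    (inv_lift sF) _ _ _ _ (pw_pullback_whr f (pG.2 mu' Hmu'))).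
  + exact: inv_compE (inv_idt _) (inv_idt _).
  + by apply: lift_nat; apply: vlift_comparison.
  + apply: lift_nat; apply: tot_inj; rewrite [RHS]tot_comp tot_id_sw.
    rewrite mcomp_idl ?comp1_idr // !mnorm.
    move/(congr1 (@tot _ _ _)): (Ee ord0); rewrite !mnorm => /mor_rewrite->.
    by have /heq_tot := lax_p (lax_ax F); rewrite !mnorm => ->.
  + apply: lift_nat; apply: tot_inj.
    rewrite [LHS]tot_comp tot_t [RHS]tot_comp tot_whr tot_whl !tot_Tp !mnorm.
    have := whl_eq T' (lax_p (lax_ax F)); rewrite !mnorm => ->.
    by have := m_interchange (dist F) (tp D); rewrite !mnorm => ->.
  + apply: lift_nat; apply: tot_inj; rewrite [LHS]tot_comp tot_id_sw.
    rewrite mcomp_idr ?comp1_idl // !mnorm.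
    by have /heq_tot := lax_z (lax_ax F); rewrite !mnorm => ->.
Qed.

End CompPreserves.

End Strong.
Section Sub.
Variables (K : twocat) (P : forall X Y : K, hom X Y -> Prop).
Hypothesis Pid : forall X : K, P (@id1 K X).
Hypothesis Pcomp : forall (X Y Z : K) (H : hom Y Z) (F : hom X Y),
  P H -> P F -> P (H ∘ F).

Record sub_mor (X Y : K) := SubMor { sub1 :> hom X Y; sub_ax : P sub1 }.

Lemma sub_mor_eq (X Y : K) (F G : sub_mor X Y) : sub1 F = sub1 G -> F = G.
Proof.
case: F G => F PF [G PG] /= e; case: _ / e PG => PG.
by rewrite (proof_irrelevance _ PF PG).
Qed.

Definition sub_hom (X Y : K) : category := {|
  obj := sub_mor X Y;
  arr := fun F G => sub1 F ⇒ sub1 G;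
  idt := fun F => idt (sub1 F);
  comp := fun F G H psi phi => comp psi phi;
  comp1l := fun F G phi => comp1l phi;
  comp1r := fun F G phi => comp1r phi;
  compA := fun F G H I h g f => compA h g f |}.

Lemma sub_heq (X Y : K) (F G F' G' : sub_hom X Y)
    (phi : sub1 F ⇒ sub1 G) (psi : sub1 F' ⇒ sub1 G') :
  F = F' -> G = G' -> phi ≈ psi -> @heq (sub_hom X Y) F G phi F' G' psi.
Proof.
move=> eF eG; case: _ / eF psi => psi; case: _ / eG psi => psi.
by move/heq_eq->.
Qed.

Definition sub_id (X : K) : sub_hom X X := SubMor (Pid X).
Definition sub_comp (X Y Z : K) (H : sub_hom Y Z) (F : sub_hom X Y) : sub_hom X Z :=
  SubMor (Pcomp (sub_ax H) (sub_ax F)).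

Definition sub2 : twocat.
Proof.
refine (@TwoCat (ob K) sub_hom sub_id sub_comp
  (fun X Y Z H F F' phi => sub1 H ◁ (phi : sub1 F ⇒ sub1 F'))
  (fun X Y Z H H' F phi => (phi : sub1 H ⇒ sub1 H') ▷ sub1 F)
  _ _ _ _ _ _ _ _ _ _ _ _ _).
- by move=> X Y F; apply/sub_mor_eq/comp1_idl.
- by move=> X Y F; apply/sub_mor_eq/comp1_idr.
- by move=> X Y Z W H G F; apply/sub_mor_eq/comp1_assoc.
- by move=> X Y Z H F; apply: whl_id.
- by move=> X Y Z H F F' F'' psi phi; apply: whl_comp.
- by move=> X Y Z H F; apply: whr_id.
- by move=> X Y Z H H' H'' F psi phi; apply: whr_comp.
- by move=> X Y F F' phi; apply: sub_heq; [exact/sub_mor_eq/comp1_idl..|exact: whl_id1].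
- by move=> X Y F F' phi; apply: sub_heq; [exact/sub_mor_eq/comp1_idr..|exact: whr_id1].
- by move=> X Y Z W H G F F' phi; apply: sub_heq; [exact/sub_mor_eq/esym/comp1_assoc..|exact: whl_comp1].
- by move=> X Y Z W H H' G F phi; apply: sub_heq; [exact/sub_mor_eq/comp1_assoc..|exact: whr_comp1].
- by move=> X Y Z W H G G' F phi; apply: sub_heq; [exact/sub_mor_eq/esym/comp1_assoc..|exact: whl_whr].
- by move=> X Y Z H H' F F' psi phi; apply: interchange.
Defined.

End Sub.

Definition Tng_strong (K : twocat) : twocat :=
  @sub2 (Tng K) (fun X X' F => is_strong F) (@id_strong K)
    (fun X Y Z H F => @comp_strong K X Y Z H F).

Lemma comp_strong_ftl (K : twocat) (X Y Z : tangentad K)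
    (H : lax_mor Y Z) (F : lax_mor X Y) :
  is_strong H /\ preserves_ftl (mor1 H) -> is_strong F /\ preserves_ftl (mor1 F) ->
  is_strong (tng_comp H F) /\ preserves_ftl (mor1 (tng_comp H F)).
Proof.
move=> [sH pH] [sF pF]; split; first exact: comp_strong.
exact: preserves_ftl_comp.
Qed.

(* Invertibility of the distributive 2-morphism does not entail preservation of
   the fundamental tangent limits, hence this further restriction of
   [Tng_strong]. *)
Definition Tng_strong_ftl (K : twocat) : twocat :=
  @sub2 (Tng K) (fun X X' F => is_strong F /\ preserves_ftl (mor1 F))
    (fun X => conj (id_strong X) (preserves_ftl_id X))
    (fun X Y Z H F => @comp_strong_ftl K X Y Z H F).

Section Inserter.
Variables (K : twocat) (X X' : K) (F G : hom X X').

Section Insert.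
Variable Y : K.

Record insert_ob := InsertOb {
  ins1 : hom Y X;
  ins2 : F ∘ ins1 ⇒ G ∘ ins1 }.

Record insert_arr (A B : insert_ob) := InsertArr {
  ins_arr :> ins1 A ⇒ ins1 B;
  ins_ax : comp (ins2 B) (F ◁ ins_arr) = comp (G ◁ ins_arr) (ins2 A) }.

Lemma insert_arr_eq (A B : insert_ob) (phi psi : insert_arr A B) :
  ins_arr phi = ins_arr psi -> phi = psi.
Proof.
case: phi psi => phi Hphi [psi Hpsi] /= e; case: _ / e Hpsi => Hpsi.
by rewrite (proof_irrelevance _ Hphi Hpsi).
Qed.

Lemma insert_id_ax (A : insert_ob) :
  comp (ins2 A) (F ◁ idt (ins1 A)) = comp (G ◁ idt (ins1 A)) (ins2 A).
Proof. by rewrite !whl_id comp1l comp1r. Qed.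

Lemma insert_comp_ax (A B C : insert_ob) (psi : insert_arr B C) (phi : insert_arr A B) :
  comp (ins2 C) (F ◁ comp psi phi) = comp (G ◁ comp psi phi) (ins2 A).
Proof. by rewrite !whl_comp compA ins_ax -compA ins_ax compA. Qed.

Definition Insert : category := {|
  obj := insert_ob;
  arr := insert_arr;
  idt := fun A => InsertArr (insert_id_ax A);
  comp := fun A B C psi phi => InsertArr (insert_comp_ax psi phi);
  comp1l := fun A B phi =>
    insert_arr_eq (comp1l (ins_arr phi) : ins_arr (InsertArr _) = _);
  comp1r := fun A B phi =>
    insert_arr_eq (comp1r (ins_arr phi) : ins_arr (InsertArr _) = _);
  compA := fun A B C D h g f =>
    insert_arr_eq (compA (ins_arr h) (ins_arr g) (ins_arr f) :
                   ins_arr (InsertArr _) = ins_arr (InsertArr _)) |}.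

Variables (I : K) (V : hom I X) (theta : F ∘ V ⇒ G ∘ V).

(* [theta_H], regarded as a 2-morphism F ∘ (V ∘ H) ⇒ G ∘ (V ∘ H). *)
Definition insert_cell (H : hom Y I) : F ∘ (V ∘ H) ⇒ G ∘ (V ∘ H) :=
  idt (G ∘ (V ∘ H)) • (theta ▷ H) • idt (F ∘ (V ∘ H)).

Lemma insert_cell_nat (H H' : hom Y I) (psi : H ⇒ H') :
  comp (insert_cell H') (F ◁ (V ◁ psi)) = comp (G ◁ (V ◁ psi)) (insert_cell H).
Proof.
have tot_cell H0 : tot (insert_cell H0) = mwhr H0 (tot theta).
  by rewrite /insert_cell !mnorm.
apply: tot_inj; rewrite [LHS]tot_comp [RHS]tot_comp !tot_cell !mnorm.
by have := m_interchange theta psi; rewrite ?mnorm.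
Qed.

Definition insert_functor : functor (hom Y I) Insert.
Proof.
refine (@Functor (hom Y I) Insert
  (fun H => InsertOb (insert_cell H))
  (fun H H' psi => @InsertArr (InsertOb (insert_cell H)) (InsertOb (insert_cell H'))
                     (V ◁ psi) (insert_cell_nat psi)) _ _).
- by move=> H; apply: insert_arr_eq; apply: whl_id.
- by move=> H H' H'' psi phi; apply: insert_arr_eq; apply: whl_comp.
Defined.

End Insert.

Definition is_inserter (I : K) (V : hom I X) (theta : F ∘ V ⇒ G ∘ V) : Prop :=
  forall Y : K, is_isomorphism (insert_functor Y theta).

End Inserter.

Arguments is_inserter {K X X'} F G I V theta.

Definition has_inserter (K : twocat) (X X' : K) (F G : hom X X') : Prop :=
  exists (I : K) (V : hom I X) (theta : F ∘ V ⇒ G ∘ V), is_inserter F G I V theta.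

Definition admits_inserters (K : twocat) : Prop :=
  forall (X X' : K) (F G : hom X X'), has_inserter F G.

(* Main.v *)
From Stdlib Require Import ClassicalEpsilon FunctionalExtensionality.
From mathcomp Require Import all_boot.
Require Import Defs.

Set Implicit Arguments.
Unset Strict Implicit.
Unset Printing Implicit Defensive.

Local Open Scope cell_scope.

(** The inserter [I] of [F] and [G] is the universal object over which [F] maps
    to [G], so a 1-morphism into [I] is a 1-morphism [H] into [X] together with
    a 2-morphism [F ∘ H ⇒ G ∘ H].  To give [I] an endomorphism lying over
    [A ∘ V], with [A] an endomorphism of [X], one therefore needs a 2-morphism
    [F ∘ A ∘ V ⇒ G ∘ A ∘ V].  Suppose that [A] has a companion [A'] on [X'],
    with comparison 2-morphisms [a : F ∘ A ⇒ A' ∘ F] and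
    [b : G ∘ A ⇒ A' ∘ G], the second one invertible; then the composite of
    [a], of [A'] applied to [theta], and of the inverse of [b] will do.
    Such quadruples ([endo]) are closed under composition, and a 2-morphism of
    endomorphisms of [X] with a companion on [X'] compatible with the
    comparisons lifts to [I] as well ([endo_cell_lift]).

    A lax tangent morphism [F] and a strong one [G] make [T], [T ∘ T] and the
    identity into such quadruples, and the axioms of a lax tangent morphism
    say precisely that [p], [z], [l] and [c] are compatible.  The
    fibre powers [Tn] belong to the picture because [G] is strong and preserves
    them: then [G ∘ Tn n] is isomorphic to [Tn' n ∘ G].  This transports all
    the tangent data to [I], strictly over [X] ([over_data_exists]).

    The axioms follow by reflection along [V].  Equations are reflected
    since [V] is faithful on 2-morphisms.  A cone in [K(Y, I)] is a limit as
    soon as its images under [V] and under [G ∘ V] are: the first gives the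
    mediating 2-morphism over [X], the second gives enough cancellation to see
    that it commutes with the cells inserted by [theta]
    ([universal_reflects_nfold], [universal_reflects_pullback]).  The images
    under [V] are restrictions along [V] of limits of [X], which are pointwise,
    and [G] preserves those.

    For the universal property among tangentads, a lax tangent morphism into
    [X] with a tangent 2-morphism [tau] is first lifted to a 1-morphism [L]
    into [I].  Its distributive 2-morphism lifts to [L] because
    compatibility with the inserted cells is, up to the invertible [dist G],
    the equation making [tau] a tangent 2-morphism; the lax axioms are
    reflected by [V] ([lift_is_lax]).  The universal property passes to a
    locally full sub-2-category as soon as the latter contains [V] and
    composition with [V] reflects membership ([sub_has_inserter]).  This holds
    for strong morphisms, since [V] is conservative on 2-morphisms, and for
    strong morphisms preserving the fundamental tangent limits, by the
    same reflection of limits.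

    Since composition of 1-morphisms is associative and unital only up to
    propositional equality, equations between 2-morphisms are mostly proved
    after applying [tot], which forgets the endpoints. *)

(** * Arrows and limits up to equality of endpoints *)

Section Tot.
Variable C : category.

Lemma tot_dom (a b a' b' : C) (f : a ⇒ b) (g : a' ⇒ b') : tot f = tot g -> a = a'.
Proof. by move/heq_tot; case. Qed.

Lemma tot_cod (a b a' b' : C) (f : a ⇒ b) (g : a' ⇒ b') : tot f = tot g -> b = b'.
Proof. by move/heq_tot; case. Qed.

Lemma recast (a b a' b' : C) (f : a ⇒ b) :
  a = a' -> b = b' -> exists f' : a' ⇒ b', tot f' = tot f.
Proof. by move=> <- <-; exists f. Qed.

Lemma tot_comp_eq (a b b' c : C) (g : b ⇒ c) (f : a ⇒ b) (g' : b' ⇒ c) (f' : a ⇒ b') :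
  comp g f = comp g' f' <-> tot g ⊙ tot f = tot g' ⊙ tot f'.
Proof. by rewrite -!tot_comp; split=> [->|/tot_inj]. Qed.

(** Fibre powers of order at least one have a projection, hence the equalities
    between the arrows already identify all the endpoints.  The property [Φ] is
    arbitrary so that the lemma serves for limits and pointwise limits
    alike. *)
Lemma nfold_transport n
    (Φ : forall a b P : C, (a ⇒ b) -> ('I_n -> (P ⇒ a)) -> Prop)
    (a b P a' b' P' : C) (p : a ⇒ b) (pi : 'I_n -> (P ⇒ a))
    (p' : a' ⇒ b') (pi' : 'I_n -> (P' ⇒ a')) :
  0 < n -> tot p = tot p' -> (forall k, tot (pi k) = tot (pi' k)) ->
  Φ a b P p pi -> Φ a' b' P' p' pi'.
Proof.
move=> n0 /[dup] /tot_dom ea /[dup] /tot_cod eb Ep Epi.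
have eP := tot_dom (Epi (Ordinal n0)).
case: _ / ea p' pi' Ep Epi => p' pi'; case: _ / eb p' => p'.
case: _ / eP pi' => pi' /tot_inj<- Epi.
suff -> : pi' = pi by [].
by apply: functional_extensionality => k; apply: tot_inj.
Qed.

Lemma pullback_transport
    (Φ : forall P a b c : C, (P ⇒ a) -> (P ⇒ b) -> (a ⇒ c) -> (b ⇒ c) -> Prop)
    (P a b c P' a' b' c' : C)
    (f : P ⇒ a) (g : P ⇒ b) (h : a ⇒ c) (k : b ⇒ c)
    (f' : P' ⇒ a') (g' : P' ⇒ b') (h' : a' ⇒ c') (k' : b' ⇒ c') :
  tot f = tot f' -> tot g = tot g' -> tot h = tot h' -> tot k = tot k' ->
  Φ P a b c f g h k -> Φ P' a' b' c' f' g' h' k'.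
Proof.
move=> /[dup] /tot_dom eP /[dup] /tot_cod ea Ef /[dup] /tot_cod eb Eg.
move=> /[dup] /tot_cod ec Eh Ek.
case: _ / eP f' g' Ef Eg => f' g'; case: _ / ea f' h' Eh => f' h'.
case: _ / eb g' k' Ek => g' k'; case: _ / ec h' k' => h' k'.
by move=> /tot_inj<- /tot_inj<- /tot_inj<- /tot_inj<-.
Qed.

Lemma nfold_monic (a b P Q : C) (p : a ⇒ b) n (pi : 'I_n -> (P ⇒ a)) (u v : Q ⇒ P) :
  is_nfold_pullback p pi -> (forall k, comp (pi k) u = comp (pi k) v) -> u = v.
Proof.
move=> [cone univ] E.
have [i j|w [_ uw]] := univ Q (fun i => comp (pi i) u).
  by rewrite !compA (cone i j).
by rewrite -(uw u) //; apply: uw => i; rewrite E.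
Qed.

Lemma pullback_monic (P a b c Q : C) (f : P ⇒ a) (g : P ⇒ b) (h : a ⇒ c) (k : b ⇒ c)
    (u v : Q ⇒ P) :
  is_pullback f g h k -> comp f u = comp f v -> comp g u = comp g v -> u = v.
Proof.
move=> [cone univ] Ef Eg.
have [|w [_ uw]] := univ Q (comp f u) (comp g u); first by rewrite !compA cone.
by rewrite -(uw u) //; apply: uw; rewrite Ef Eg.
Qed.

End Tot.

Lemma dependent_choice (A : Type) (B : A -> Type) (P : forall a, B a -> Prop) :
  (forall a, exists b, P a b) -> exists h : forall a, B a, forall a, P a (h a).
Proof.
move=> ex; exists (fun a => proj1_sig (constructive_indefinite_description _ (ex a))).
by move=> a; case: constructive_indefinite_description.
Qed.

Lemma tot_fmap (C D : category) (Phi : functor C D) (a b a' b' : C)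
    (f : a ⇒ b) (f' : a' ⇒ b') :
  tot f = tot f' -> tot (fmap Phi f) = tot (fmap Phi f').
Proof. by move/heq_tot; case. Qed.

(** * Inserters by lifting properties *)

Definition fully_faithful (C D : category) (Phi : functor C D) : Prop :=
  forall (a b : C) (g : Phi a ⇒ Phi b), exists! f : a ⇒ b, fmap Phi f = g.

(** An inverse functor is unwieldy here, for it returns objects only equal
    to the given ones; bijectivity on objects and on hom-sets is what the
    later proofs produce and consume.  Choice rebuilds the inverse. *)
Lemma is_isomorphismP (C D : category) (Phi : functor C D) :
  is_isomorphism Phi <->
  [/\ injective Phi, forall d, exists c, Phi c = d & fully_faithful Phi].
Proof.
split=> [[Psi [K1 K2 K3 K4]]|[inj surj ff]].
  split=> [a b e|d|a b g]; first by rewrite -(K1 a) e.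
    by exists (Psi d).
  have [f Ef] := recast (fmap Psi g) (K1 a) (K1 b).
  exists f; split=> [|f' Ef'].
    by apply: tot_inj; rewrite (tot_fmap Phi Ef); apply/heq_tot/K4.
  by apply: tot_inj; rewrite Ef -Ef'; apply/heq_tot/K2.
pose ob d := proj1_sig (constructive_indefinite_description _ (surj d)).
have obK d : Phi (ob d) = d by rewrite /ob; case: constructive_indefinite_description.
have ffE d d' (g : d ⇒ d') : exists f : ob d ⇒ ob d', tot (fmap Phi f) = tot g.
  have [g' Eg'] := recast g (esym (obK d)) (esym (obK d')).
  by have [f [Ef _]] := ff _ _ g'; exists f; rewrite Ef.
have faith a b (f f' : a ⇒ b) : tot (fmap Phi f) = tot (fmap Phi f') -> f = f'.
  move/tot_inj => E; have [h [_ uh]] := ff _ _ (fmap Phi f').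
  by rewrite -(uh f) // -(uh f').
pose ar d d' (g : d ⇒ d') := proj1_sig (constructive_indefinite_description _ (ffE d d' g)).
have arK d d' (g : d ⇒ d') : tot (fmap Phi (ar d d' g)) = tot g.
  by rewrite /ar; case: constructive_indefinite_description.
have ar_id d : ar d d (idt d) = idt (ob d).
  by apply: faith; rewrite arK fmap_id; apply: tot_idt.
have ar_comp d d' d'' (g : d' ⇒ d'') (f : d ⇒ d') :
    ar d d'' (comp g f) = comp (ar d' d'' g) (ar d d' f).
  by apply: faith; rewrite arK fmap_comp !tot_comp !arK.
exists (Functor ar_id ar_comp); split=> //=.
- by move=> a; apply: inj; apply: obK.
- move=> a b f; apply/heq_tot.
  have [f' Ef'] := recast (ar _ _ (fmap Phi f)) (inj _ _ (obK (Phi a))) (inj _ _ (obK (Phi b))).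
  by rewrite -Ef'; congr tot; apply: faith; rewrite (tot_fmap Phi Ef') arK.
- by move=> a b f; apply/heq_tot; apply: arK.
Qed.

Section InserterP.
Variables (K : twocat) (X X' : K) (F G : hom X X').
Variables (I : K) (V : hom I X) (theta : F ∘ V ⇒ G ∘ V).

Lemma tot_insert_cell Y (H : hom Y I) : tot (insert_cell theta H) = mwhr H (tot theta).
Proof. by rewrite /insert_cell !mnorm. Qed.

Lemma insert_ob_eq Y (A B : Insert F G Y) :
  ins1 A = ins1 B -> tot (ins2 A) = tot (ins2 B) -> A = B.
Proof. by case: A B => A a [B b] /= e; case: _ / e b => b /tot_inj->. Qed.

(** Type ascription only: it presents an arrow of [Insert] whose endpoints come
    from 1-morphisms into [I] as a 2-morphism of [K]. *)
Let ins_cell Y (H H' : hom Y I)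
  (m : insert_arr (InsertOb (insert_cell theta H)) (InsertOb (insert_cell theta H'))) :
  V ∘ H ⇒ V ∘ H' := ins_arr m.

Definition lifts_cells : Prop :=
  forall Y (H H' : hom Y I) (phi : V ∘ H ⇒ V ∘ H'),
    comp (insert_cell theta H') (F ◁ phi) = comp (G ◁ phi) (insert_cell theta H) ->
    exists! psi : H ⇒ H', V ◁ psi = phi.

Definition lifts_inj : Prop :=
  forall Y (H H' : hom Y I), V ∘ H = V ∘ H' -> theta ▷ H ≈ theta ▷ H' -> H = H'.

Definition lifts_obs : Prop :=
  forall Y (H : hom Y X) (tau : F ∘ H ⇒ G ∘ H),
    exists2 L : hom Y I, V ∘ L = H & theta ▷ L ≈ tau.

Lemma is_inserterP :
  is_inserter F G I V theta <-> [/\ lifts_inj, lifts_obs & lifts_cells].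
Proof.
split=> [ins|[inj surj ff] Y].
  split=> [Y H H' e /heq_tot Ht|Y H tau|Y H H' phi Ephi];
    have /is_isomorphismP [inj surj ff] := ins Y.
  - apply: inj; apply: insert_ob_eq => //=.
    by rewrite !tot_insert_cell.
  - have [L EL] := surj (InsertOb tau); exists L.
      by have := congr1 (@ins1 _ _ _ _ _ _) EL.
    apply/heq_tot; rewrite tot_whr -tot_insert_cell.
    by have := congr1 (fun A => tot (ins2 A)) EL.
  - have [psi [Epsi u]] := ff _ _ (@InsertArr _ _ _ _ _ _ (InsertOb _) (InsertOb _) phi Ephi).
    exists psi; split; first by have := congr1 (@ins_cell Y H H') Epsi.
    by move=> psi' E; apply: u; apply: insert_arr_eq.
apply/is_isomorphismP; split=> [H H' E|[H tau]|H H' [phi Ephi]].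
- apply: inj; first by have := congr1 (@ins1 _ _ _ _ _ _) E.
  by apply/heq_tot; rewrite !tot_whr -!tot_insert_cell; have := congr1 (fun A => tot (ins2 A)) E.
- have [L EL /heq_tot Et] := surj Y H tau; exists L; apply: insert_ob_eq => //=.
  by rewrite tot_insert_cell.
- have [psi [Epsi u]] := ff Y H H' phi Ephi; exists psi; split.
    exact: insert_arr_eq.
  by move=> psi' E; apply: u; have := congr1 (@ins_arr _ _ _ _ _ _ _ _) E.
Qed.

End InserterP.

Lemma faithful_tot (K : twocat) (Y I X : K) (V : hom I X) :
  (forall (H H' : hom Y I) (f g : H ⇒ H'), V ◁ f = V ◁ g -> f = g) ->
  forall (H H' L L' : hom Y I) (f : H ⇒ H') (g : L ⇒ L'),
    H = L -> H' = L' -> mwhl V (tot f) = mwhl V (tot g) -> tot f = tot g.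
Proof.
move=> faith H H' L L' f g e e'.
by case: _ / e g => g; case: _ / e' g => g /tot_inj/faith->.
Qed.

(** * Reflection along the universal 1-morphism *)

Section Reflection.
Variables (K : twocat) (X X' : K) (F G : hom X X').
Variables (I : K) (V : hom I X) (theta : F ∘ V ⇒ G ∘ V).
Hypothesis ins : is_inserter F G I V theta.

(** An arrow of [Insert] is a mere 2-morphism subject to a property, so the
    isomorphism with [Insert] makes [V] faithful. *)
Lemma universal_faithful Y (H H' : hom Y I) (f g : H ⇒ H') : V ◁ f = V ◁ g -> f = g.
Proof.
have [_ _ ff] := (is_inserterP _).1 ins => E.
have [h [_ uh]] := ff _ _ _ _ (insert_cell_nat theta g).
by rewrite -(uh f) // -(uh g).
Qed.

Lemma universal_reflects_tot Y (H H' L L' : hom Y I) (f : H ⇒ H') (g : L ⇒ L') :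
  H = L -> H' = L' -> mwhl V (tot f) = mwhl V (tot g) -> tot f = tot g.
Proof. exact/faithful_tot/universal_faithful. Qed.

(** The mediating 2-morphism [u] over [X] must commute with the cells inserted
    by [theta] in order to come from [I].  Both composites land in
    [G ∘ (V ∘ P)], where they can be compared after the projections. *)
Lemma universal_reflects_nfold Y n (a b P : hom Y I) (p : a ⇒ b) (pi : 'I_n -> (P ⇒ a)) :
  is_nfold_pullback (V ◁ p) (fun k => V ◁ pi k) ->
  is_nfold_pullback (G ◁ (V ◁ p)) (fun k => G ◁ (V ◁ pi k)) ->
  is_nfold_pullback p pi.
Proof.
move=> [cone univ] pbG; have [_ _ ff] := (is_inserterP _).1 ins.
split=> [i j|Q q Hq].
  by apply: universal_faithful; rewrite !whl_comp.
have [i j|u [Hu uniq]] := univ _ (fun k => V ◁ q k).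
  by rewrite -!whl_comp (Hq i j).
have [|v [Ev uv]] := ff _ Q P u.
  apply: (nfold_monic pbG) => k.
  rewrite compA -insert_cell_nat -compA -whl_comp Hu.
  by rewrite insert_cell_nat [RHS]compA -whl_comp Hu.
exists v; split=> [k|w Hw].
  by apply: universal_faithful; rewrite whl_comp Ev.
by apply: uv; symmetry; apply: uniq => k; rewrite -whl_comp Hw.
Qed.

Lemma universal_reflects_pullback Y (P a b c : hom Y I)
    (f : P ⇒ a) (g : P ⇒ b) (h : a ⇒ c) (k : b ⇒ c) :
  is_pullback (V ◁ f) (V ◁ g) (V ◁ h) (V ◁ k) ->
  is_pullback (G ◁ (V ◁ f)) (G ◁ (V ◁ g)) (G ◁ (V ◁ h)) (G ◁ (V ◁ k)) ->
  is_pullback f g h k.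
Proof.
move=> [cone univ] pbG; have [_ _ ff] := (is_inserterP _).1 ins.
split=> [|Q x y Hxy].
  by apply: universal_faithful; rewrite !whl_comp.
have [|u [[Hx Hy] uniq]] := univ _ (V ◁ x) (V ◁ y).
  by rewrite -!whl_comp Hxy.
have [|v [Ev uv]] := ff _ Q P u.
  apply: (pullback_monic pbG);
    by rewrite compA -insert_cell_nat -compA -whl_comp ?Hx ?Hy insert_cell_nat
      [RHS]compA -whl_comp ?Hx ?Hy.
exists v; split=> [|w [Hwx Hwy]].
  by split; apply: universal_faithful; rewrite whl_comp Ev.
by apply: uv; symmetry; apply: uniq; rewrite -!whl_comp Hwx Hwy.
Qed.

(** Postcomposition commutes with restriction along [E], so the restricted
    cones are covered by the previous lemmas. *)
Lemma universal_reflects_pw_nfold Y n (a b P : hom Y I) (p : a ⇒ b) (pi : 'I_n -> (P ⇒ a)) :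
  0 < n ->
  pointwise_nfold_pullback (V ◁ p) (fun k => V ◁ pi k) ->
  pointwise_nfold_pullback (G ◁ (V ◁ p)) (fun k => G ◁ (V ◁ pi k)) ->
  pointwise_nfold_pullback p pi.
Proof.
move=> n0 [pbV pwV] [pbG pwG]; split; first exact: universal_reflects_nfold.
move=> Z E; apply: universal_reflects_nfold.
- by apply: (nfold_transport (Φ := fun _ _ _ p pi => is_nfold_pullback p pi) n0 _ _ (pwV Z E)) => [|k];
    rewrite /= !tot_whr !tot_whl mwhr_mwhl.
- by apply: (nfold_transport (Φ := fun _ _ _ p pi => is_nfold_pullback p pi) n0 _ _ (pwG Z E)) => [|k];
    rewrite /= !tot_whr !tot_whl !mwhr_mwhl.
Qed.

Lemma universal_reflects_pw_pullback Y (P a b c : hom Y I)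
    (f : P ⇒ a) (g : P ⇒ b) (h : a ⇒ c) (k : b ⇒ c) :
  pointwise_pullback (V ◁ f) (V ◁ g) (V ◁ h) (V ◁ k) ->
  pointwise_pullback (G ◁ (V ◁ f)) (G ◁ (V ◁ g)) (G ◁ (V ◁ h)) (G ◁ (V ◁ k)) ->
  pointwise_pullback f g h k.
Proof.
move=> [pbV pwV] [pbG pwG]; split; first exact: universal_reflects_pullback.
move=> Z E; apply: universal_reflects_pullback.
- by apply: (pullback_transport (Φ := fun _ _ _ _ f g h k => is_pullback f g h k) _ _ _ _ (pwV Z E));
    rewrite /= !tot_whr !tot_whl mwhr_mwhl.
- by apply: (pullback_transport (Φ := fun _ _ _ _ f g h k => is_pullback f g h k) _ _ _ _ (pwG Z E));
    rewrite /= !tot_whr !tot_whl !mwhr_mwhl.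
Qed.

(** The inverse over [X] commutes with the inserted cells because the
    2-morphism itself does. *)
Lemma universal_reflects_inv Y (H H' : hom Y I) (f : H ⇒ H') :
  is_invertible (V ◁ f) -> is_invertible f.
Proof.
move=> [g [g1 g2]]; have [_ _ ff] := (is_inserterP _).1 ins.
have [|h [Eh _]] := ff _ _ _ g.
  have : comp (G ◁ V ◁ f) (comp (insert_cell theta H) (F ◁ g)) =
         comp (G ◁ V ◁ f) (comp (G ◁ g) (insert_cell theta H')).
    rewrite compA -insert_cell_nat -compA -whl_comp g2 whl_id comp1r.
    by rewrite [RHS]compA -whl_comp g2 whl_id comp1l.
  move/(congr1 (comp (G ◁ g))); rewrite [LHS]compA [RHS]compA -whl_comp g1.
  by rewrite whl_id !comp1l.
by exists h; split; apply: universal_faithful; rewrite whl_comp Eh ?g1 ?g2 whl_id.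
Qed.

End Reflection.

(** * Lifting endomorphisms of a parallel pair *)

Section Endo.
Variables (K : twocat) (X X' : K) (F G : hom X X').

(** A pair of endomorphisms related laxly along [F] and invertibly along [G].
    Endomorphisms of this kind act on the cells [F ∘ V ⇒ G ∘ V], which is why
    they extend to the inserter. *)
Record endo := Endo {
  end1 : hom X X;
  end1' : hom X' X';
  endF : F ∘ end1 ⇒ end1' ∘ F;
  endG : G ∘ end1 ⇒ end1' ∘ G;
  endG_inv : is_invertible endG }.

Definition endo_cell (A B : endo) (f : end1 A ⇒ end1 B) (f' : end1' A ⇒ end1' B) : Prop :=
  comp (f' ▷ F) (endF A) = comp (endF B) (F ◁ f) /\
  comp (f' ▷ G) (endG A) = comp (endG B) (G ◁ f).

Variables (I : K) (V : hom I X) (theta : F ∘ V ⇒ G ∘ V).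
Hypothesis ins : is_inserter F G I V theta.

(** [L] lies strictly over [end1 A], and [theta] is compatible with the
    comparison 2-morphisms.  For the tangent bundles
    with their distributive 2-morphisms, the equation says that [theta] is a tangent 2-morphism. *)
Definition endo_lift (A : endo) (L : hom I I) : Prop :=
  V ∘ L = end1 A ∘ V /\
  mwhr V (tot (endG A)) ⊙ mwhr L (tot theta) =
  mwhl (end1' A) (tot theta) ⊙ mwhr V (tot (endF A)).

(** The equation of [endo_lift] determines the cell of [L], since [endG A] can be
    inverted. *)
Lemma endo_lift_exists (A : endo) : exists L, endo_lift A L.
Proof.
have [b' [_ b2]] := endG_inv A; have [_ surj _] := (is_inserterP _).1 ins.
have [L EL /heq_tot Et] := surj I (end1 A ∘ V)
  (idt (G ∘ (end1 A ∘ V)) • (b' ▷ V) • (end1' A ◁ theta) • (endF A ▷ V)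
     • idt (F ∘ (end1 A ∘ V))).
exists L; split=> //; move: Et; rewrite !mnorm => ->.
rewrite !mcompA -mwhr_comp // -tot_comp b2 mwhr_idt.
by rewrite -[X in _ ⊙ X ⊙ _]tot_whl mcomp_idl // comp1_assoc.
Qed.

(** Compatibility with the inserted cells may be tested after the invertible
    [endG B], and then is the naturality of [f'] at [theta]. *)
Lemma endo_cell_lift (A B : endo) (LA LB : hom I I)
    (f : end1 A ⇒ end1 B) (f' : end1' A ⇒ end1' B) :
  endo_lift A LA -> endo_lift B LB -> endo_cell f f' ->
  exists h : LA ⇒ LB, mwhl V (tot h) = mwhr V (tot f).
Proof.
move=> [EA HA] [EB HB] [fF fG].
have [_ _ ff] := (is_inserterP _).1 ins.
have [phi Ephi] := recast (f ▷ V) (esym EA) (esym EB).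
have [|h [Eh _]] := ff _ LA LB phi; last by exists h; rewrite -tot_whl Eh.
apply/tot_comp_eq; rewrite !tot_insert_cell !tot_whl Ephi.
have [d [d1 d2]] := endG_inv B.
have key : mwhr V (tot (endG B)) ⊙ (mwhr LB (tot theta) ⊙ mwhl F (tot (f ▷ V))) =
           mwhr V (tot (endG B)) ⊙ (mwhl G (tot (f ▷ V)) ⊙ mwhr LA (tot theta)).
  rewrite !tot_whr !mcompA HB.
  have := whr_eq V (eq_heq fF); rewrite !mnorm => /esym/mor_rewrite->.
  have := whr_eq V (eq_heq fG); rewrite !mnorm => <-.
  rewrite -[RHS]mcompA HA !mcompA; congr (_ ⊙ _).
  by have := m_interchange f' theta; rewrite ?mnorm => ->.
move/(congr1 (fun m => mwhr V (tot d) ⊙ m)): key; rewrite !mcompA.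
have -> : mwhr V (tot d) ⊙ mwhr V (tot (endG B)) = tot (idt (G ∘ end1 B ∘ V)).
  by rewrite -mwhr_comp // -tot_comp d1 mwhr_idt.
rewrite -!tot_whr -!tot_whl mcomp_idl ?mcomp_idl //.
by rewrite comp1_assoc.
by rewrite -comp1_assoc EB comp1_assoc.
Qed.

End Endo.

(** * Comparison 2-morphisms of tangent morphisms *)

Section Swap.
Variables (K : twocat) (X X' : K) (F : hom X X').

Definition swap_id : F ∘ id1 ⇒ id1 ∘ F := idt (id1 ∘ F) • idt (F ∘ id1).

Lemma tot_swap_id : tot swap_id = tot (idt F).
Proof. by rewrite /swap_id tot_idtr comp1_idl. Qed.

Lemma swap_id_inv : is_invertible swap_id.
Proof. exact: inv_compE (inv_idt _) (inv_idt _). Qed.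

Variables (A : hom X X) (A' : hom X' X') (a : F ∘ A ⇒ A' ∘ F).

Definition swap_comp (B : hom X X) (B' : hom X' X') (b : F ∘ B ⇒ B' ∘ F) :
    F ∘ (A ∘ B) ⇒ (A' ∘ B') ∘ F :=
  idt ((A' ∘ B') ∘ F) • ((A' ◁ b) • (a ▷ B)) • idt (F ∘ (A ∘ B)).

Lemma tot_swap_comp (B : hom X X) (B' : hom X' X') (b : F ∘ B ⇒ B' ∘ F) :
  tot (swap_comp b) = mwhl A' (tot b) ⊙ mwhr B (tot a).
Proof. by rewrite /swap_comp !mnorm. Qed.

Lemma swap_comp_inv (B : hom X X) (B' : hom X' X') (b : F ∘ B ⇒ B' ∘ F) :
  is_invertible a -> is_invertible b -> is_invertible (swap_comp b).
Proof.
move=> ia ib; apply: inv_compE (inv_idt _); apply: inv_compE (inv_idt _) _.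
by apply: inv_compE; [apply: (@inv_fmap _ _ (postcomp _ A')) | apply: (@inv_fmap _ _ (precomp _ B))].
Qed.

Lemma swap_comp_nat (B C : hom X X) (B' C' : hom X' X')
    (b : F ∘ B ⇒ B' ∘ F) (c : F ∘ C ⇒ C' ∘ F) (f : B ⇒ C) (f' : B' ⇒ C') :
  comp (f' ▷ F) b = comp c (F ◁ f) ->
  comp ((A' ◁ f') ▷ F) (swap_comp b) = comp (swap_comp c) (F ◁ (A ◁ f)).
Proof.
move=> E; apply/tot_comp_eq; rewrite !tot_swap_comp !mnorm.
have := whl_eq A' (eq_heq E); rewrite !mnorm => ->.
by have := m_interchange a f; rewrite ?mnorm => /esym/mor_rewrite->; rewrite !mcompA.
Qed.

End Swap.

Section LaxSwap.
Variables (K : twocat) (X X' : tangentad K) (F : lax_mor X X').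
Local Notation D := (tdata (tstr X)).
Local Notation D' := (tdata (tstr X')).
Local Notation T := (tT D).
Local Notation T' := (tT D').
Local Notation f := (mor1 F).

Definition swapTT : f ∘ (T ∘ T) ⇒ (T' ∘ T') ∘ f := swap_comp (dist F) (dist F).

Lemma swap_p : comp (tp D' ▷ f) (dist F) = comp (swap_id f) (f ◁ tp D).
Proof.
apply/tot_comp_eq; rewrite tot_swap_id mcomp_idl ?comp1_idr //.
by have /heq_tot := lax_p (lax_ax F); rewrite tot_compE.
Qed.

Lemma swap_z : comp (tz D' ▷ f) (swap_id f) = comp (dist F) (f ◁ tz D).
Proof.
apply/tot_comp_eq; rewrite tot_swap_id mcomp_idr ?comp1_idl //.
by have /heq_tot := lax_z (lax_ax F); rewrite tot_compE.
Qed.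

Lemma swap_l : comp (tl D' ▷ f) (dist F) = comp swapTT (f ◁ tl D).
Proof.
apply/tot_comp_eq; rewrite tot_swap_comp.
by have /heq_tot := lax_l (lax_ax F); rewrite !tot_compE.
Qed.

Lemma swap_c : comp (tc D' ▷ f) swapTT = comp swapTT (f ◁ tc D).
Proof.
apply/tot_comp_eq; rewrite tot_swap_comp mcompA.
by have /heq_tot := lax_c (lax_ax F); rewrite !tot_compE.
Qed.

Lemma Tn_whr_pullback n : 0 < n ->
  is_nfold_pullback (tp D' ▷ f) (fun k => tpi D' n k ▷ f).
Proof. by move=> n0; case: (ax_Tn (tax (tstr X')) n0) => [[_ pw] _]; apply: pw. Qed.

Lemma swapTn n : 0 < n -> exists a : f ∘ Tn D n ⇒ Tn D' n ∘ f,
  forall k, comp (tpi D' n k ▷ f) a = comp (dist F) (f ◁ tpi D n k).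
Proof.
move=> n0; have [_ univ] := Tn_whr_pullback n0.
have [|a [Ea _]] := univ _ (fun k => comp (dist F) (f ◁ tpi D n k)).
  move=> i j; rewrite !compA swap_p -!compA -!whl_comp.
  by have [[[cone _] _] _] := ax_Tn (tax (tstr X)) n0; rewrite (cone i j).
by exists a.
Qed.

(** The comparison for [Tn 2] is the pairing that occurs in the lax axiom, as
    both have the same projections. *)
Lemma swap_s (a : f ∘ Tn D 2 ⇒ Tn D' 2 ∘ f) :
  (forall k, comp (tpi D' 2 k ▷ f) a = comp (dist F) (f ◁ tpi D 2 k)) ->
  comp (ts D' ▷ f) a = comp (dist F) (f ◁ ts D).
Proof.
move=> Ea; have [u [u1 u2] Es] := lax_s (lax_ax F).
suff -> : a = u.
  by apply/tot_comp_eq; move/heq_tot: Es; rewrite !tot_compE.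
by apply: (pair_monic (Tn_whr_pullback (isT : 0 < 2)));
  rewrite Ea ?[RHS]u1 ?[RHS]u2 compE_comp.
Qed.

Hypotheses (sF : is_strong F) (pF : preserves_ftl f).

Lemma swap_iter m : exists b : f ∘ iter1 T m ⇒ iter1 T' m ∘ f, is_invertible b.
Proof.
elim: m => [|m [b ib]] /=; first by exists (swap_id f); apply: swap_id_inv.
by exists (swap_comp (dist F) b); apply: swap_comp_inv.
Qed.

(** Preservation of [Tn n] by [F] alone does not give preservation by
    [F ∘ T^m].  Strength moves [F] to the right of [T'^m], where the axioms of
    the target apply. *)
Lemma preserves_Tn_iter n m : 0 < n ->
  pointwise_nfold_pullback (f ◁ (iter1 T m ◁ tp D))
    (fun k => f ◁ (iter1 T m ◁ tpi D n k)).
Proof.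
move=> n0; have [e ie Ee] := Tn_comparison sF pF n0; have [b ib] := swap_iter m.
have [_ /(_ m) /(pw_nfold_whr f)] := ax_Tn (tax (tstr X')) n0.
apply: pw_nfold_iso (swap_comp_inv ib sF) (swap_comp_inv ib (swap_id_inv f))
  (swap_comp_inv ib ie) _ _.
- exact/swap_comp_nat/swap_p.
- by move=> k; apply/swap_comp_nat/Ee.
Qed.

End LaxSwap.

Section EndoComp.
Variables (K : twocat) (X X' : K) (F G : hom X X').

Definition endo_id : endo F G := Endo (swap_id F) (swap_id_inv G).

Definition endo_comp (A B : endo F G) : endo F G :=
  Endo (swap_comp (endF A) (endF B)) (swap_comp_inv (endG_inv A) (endG_inv B)).

Variables (I : K) (V : hom I X) (theta : F ∘ V ⇒ G ∘ V).

Lemma endo_lift_id : endo_lift theta endo_id id1.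
Proof.
split; first by rewrite comp1_idl comp1_idr.
rewrite !tot_swap_id mwhr_id1 mwhl_id1 !mwhr_idt.
by rewrite mcomp_idl // mcomp_idr.
Qed.

Lemma endo_lift_comp (A B : endo F G) (LA LB : hom I I) :
  endo_lift theta A LA -> endo_lift theta B LB ->
  endo_lift theta (endo_comp A B) (LA ∘ LB).
Proof.
move=> [EA HA] [EB HB]; split.
  by rewrite comp1_assoc EA -comp1_assoc EB comp1_assoc.
rewrite !tot_swap_comp.
have E1 : mwhr V (mwhl (end1' A) (tot (endG B)) ⊙ mwhr (end1 B) (tot (endG A))) =
          mwhl (end1' A) (mwhr V (tot (endG B))) ⊙ mwhr LB (mwhr V (tot (endG A))).
  by rewrite -tot_whl -tot_whr mwhr_comp ?comp1_assoc // !mnorm EB.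
have E2 : mwhr V (mwhl (end1' A) (tot (endF B)) ⊙ mwhr (end1 B) (tot (endF A))) =
          mwhl (end1' A) (mwhr V (tot (endF B))) ⊙ mwhr LB (mwhr V (tot (endF A))).
  by rewrite -tot_whl -tot_whr mwhr_comp ?comp1_assoc // !mnorm EB.
have E3 : mwhr LB (mwhr V (tot (endG A))) ⊙ mwhr LB (mwhr LA (tot theta)) =
    mwhl (end1' A) (mwhr LB (tot theta)) ⊙ mwhr LB (mwhr V (tot (endF A))).
  rewrite -!tot_whr -mwhr_comp; last by rewrite -comp1_assoc EA comp1_assoc.
  by rewrite !tot_whr HA -tot_whl -tot_whr mwhr_comp ?comp1_assoc // tot_whl mwhr_mwhl.
have E4 : mwhl (end1' A) (mwhr V (tot (endG B))) ⊙ mwhl (end1' A) (mwhr LB (tot theta)) =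
    mwhl (end1' A ∘ end1' B) (tot theta) ⊙ mwhl (end1' A) (mwhr V (tot (endF B))).
  rewrite -!tot_whr -mwhl_comp; last by rewrite -comp1_assoc EB comp1_assoc.
  by rewrite !tot_whr HB -tot_whl -tot_whr mwhl_comp ?comp1_assoc // tot_whl mwhl_mwhl.
by rewrite E1 E2 -mwhr_mwhr -mcompA E3 mcompA E4 -mcompA.
Qed.

End EndoComp.

(** * Tangent data lying strictly over a tangentad *)

Section Over.
Variables (K : twocat) (X : tangentad K) (I : K) (V : hom I X).

(** [V] sends [f] to the restriction of [f'] along [V]; as an equality of arrows
    with free endpoints it also identifies the endpoints strictly. *)
Definition over (A B : hom I I) (f : A ⇒ B) (A' B' : hom X X) (f' : A' ⇒ B') : Prop :=
  mwhl V (tot f) = mwhr V (tot f').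

Lemma over_comp (A B B1 C : hom I I) (A' B' B1' C' : hom X X)
    (e : strict B B1) (e' : strict B' B1')
    (g : B1 ⇒ C) (f : A ⇒ B) (g' : B1' ⇒ C') (f' : A' ⇒ B') :
  over g g' -> over f f' -> over (@compE _ _ _ _ _ e g f) (@compE _ _ _ _ _ e' g' f').
Proof. by move=> hg hf; rewrite /over mwhl_compE mwhr_compE hg hf. Qed.

Lemma over_idt (A : hom I I) (A' : hom X X) :
  V ∘ A = A' ∘ V -> over (idt A) (idt A').
Proof. by move=> e; rewrite /over mwhl_idt mwhr_idt e. Qed.

Lemma over_whl (H A B : hom I I) (f : A ⇒ B) (H' A' B' : hom X X) (f' : A' ⇒ B') :
  V ∘ H = H' ∘ V -> over f f' -> over (H ◁ f) (H' ◁ f').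
Proof.
by move=> e hf; rewrite /over tot_whl mwhl_mwhl e -mwhl_mwhl hf tot_whl mwhr_mwhl.
Qed.

Lemma over_whr (H A B : hom I I) (f : A ⇒ B) (H' A' B' : hom X X) (f' : A' ⇒ B') :
  V ∘ H = H' ∘ V -> over f f' -> over (f ▷ H) (f' ▷ H').
Proof.
by move=> e hf; rewrite /over tot_whr -mwhr_mwhl hf mwhr_mwhr e -mwhr_mwhr.
Qed.

Lemma over_dom (A B : hom I I) (f : A ⇒ B) (A' B' : hom X X) (f' : A' ⇒ B') :
  over f f' -> V ∘ A = A' ∘ V.
Proof. exact: tot_dom. Qed.

Hypothesis faith : forall (A B : hom I I) (f g : A ⇒ B), V ◁ f = V ◁ g -> f = g.

(** The source of all equational axioms below: an equation that holds on [X] is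
    restricted along [V] and then reflected. *)
Lemma over_heq (A B A1 B1 : hom I I) (f : A ⇒ B) (g : A1 ⇒ B1)
    (A' B' A1' B1' : hom X X) (f' : A' ⇒ B') (g' : A1' ⇒ B1') :
  over f f' -> over g g' -> A = A1 -> B = B1 -> f' ≈ g' -> f ≈ g.
Proof.
rewrite /over => hf hg eA eB /heq_tot E; case: _ / eA g hg => g; case: _ / eB g => g hg.
by apply/heq_eq/faith/tot_inj; rewrite !tot_whl hf hg E.
Qed.

(** Pairings that exist on [X] lift, because pairings into a pointwise pullback
    are still determined by their components after restriction along [V]. *)
Lemma over_pairing (Q P A B : hom I I) (Q' P' A' B' : hom X X)
    (p : A ⇒ B) (p' : A' ⇒ B') (pi : 'I_2 -> (P ⇒ A)) (pi' : 'I_2 -> (P' ⇒ A'))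
    (x y : Q ⇒ A) (x' y' u' : _) :
  is_nfold_pullback p pi -> pointwise_nfold_pullback p' pi' ->
  over p p' -> (forall k, over (pi k) (pi' k)) -> over x x' -> over y y' ->
  @is_pairing _ P' A' Q' (pi' ord0) (pi' ord_max) x' y' u' ->
  exists2 u : Q ⇒ P, is_pairing (pi ord0) (pi ord_max) x y u & over u u'.
Proof.
move=> [cone univ] [[cone' _] pw'] op opi ox oy [u1 u2].
have Exy : comp p x = comp p y.
  apply: faith; apply: tot_inj.
  rewrite !tot_whl !mwhl_comp0 op ox oy -!mwhr_comp // -!tot_comp -u1 -u2.
  by rewrite !compA (cone' ord0 ord_max).
pose q (k : 'I_2) := if k == ord0 then x else y.
have [|u [Eu _]] := univ _ q.
  by move=> i j; rewrite /q; case: (i == _); case: (j == _).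
have Eu1 : comp (pi ord0) u = x := Eu ord0.
have Eu2 : comp (pi ord_max) u = y := Eu ord_max.
exists u => //.
have [v Ev] := recast (V ◁ u) (over_dom ox) (over_dom (opi ord0)).
suff E : v = u' ▷ V by rewrite /over -tot_whl -Ev E.
apply: (pair_monic (pw' I V)); apply/tot_comp_eq; cbv beta; rewrite Ev !tot_whl !tot_whr -opi.
- rewrite -mwhl_comp // -tot_comp Eu1 ox -u1 tot_comp mwhr_comp //.
  by rewrite opi.
- rewrite -mwhl_comp // -tot_comp Eu2 oy -u2 tot_comp mwhr_comp //.
  by rewrite opi.
Qed.

Local Notation D := (tdata (tstr X)).

Record over_data (DI : tangent_data I) : Prop := OverData {
  over_T : V ∘ tT DI = tT D ∘ V;
  over_p : over (tp DI) (tp D);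
  over_z : over (tz DI) (tz D);
  over_Tn : forall n, 0 < n -> V ∘ Tn DI n = Tn D n ∘ V;
  over_pi : forall n, 0 < n -> forall k, over (tpi DI n k) (tpi D n k);
  over_s : over (ts DI) (ts D);
  over_l : over (tl DI) (tl D);
  over_c : over (tc DI) (tc D) }.

Variables (DI : tangent_data I) (OD : over_data DI).
Local Notation TI := (tT DI).
Local Notation T := (tT D).

Hypothesis pbI : tn_pullbacks DI.

Let pb2 := (pbI (isT : 0 < 2)).1.1.
Let pb2T : is_nfold_pullback (tp DI ▷ TI) (fun k => tpi DI 2 k ▷ TI).
Proof. exact: (pbI (isT : 0 < 2)).1.2. Qed.
Let Tpb2 : is_nfold_pullback (TI ◁ tp DI) (fun k => TI ◁ tpi DI 2 k).
Proof.
have [+ _] := (pbI (isT : 0 < 2)).2 1.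
by move: (comp1_idr TI : iter1 TI 1 = TI); move: (iter1 _ 1) => H ->.
Qed.

Let pw2 := (ax_Tn (tax (tstr X)) (isT : 0 < 2)).1.
Let pw2T := pw_nfold_whr T pw2.
Let Tpw2 := T_Tn_pullback X (isT : 0 < 2).

Let oT := over_T OD.
Let op := over_p OD.
Let oz := over_z OD.
Let os := over_s OD.
Let ol := over_l OD.
Let oc := over_c OD.
Let o2 k : over (tpi DI 2 k) (tpi D 2 k).
Proof. exact: over_pi. Qed.
Let o3 k : over (tpi DI 3 k) (tpi D 3 k).
Proof. exact: over_pi. Qed.

Lemma over_vlift (mu' : Tn D 2 ⇒ T ∘ T) : is_vlift mu' ->
  exists2 mu : Tn DI 2 ⇒ TI ∘ TI, is_vlift mu & over mu mu'.
Proof.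
move=> [u' Pu ->].
have [u Eu ou] := over_pairing Tpb2 Tpw2 (over_whl oT op) (fun k => over_whl oT (o2 k))
  (over_comp _ _ ol (o2 ord0)) (over_comp _ _ (over_whr oT oz) (o2 ord_max)) Pu.
exists ((TI ◁ ts DI) • u); first by exists u.
exact: over_comp (over_whl oT os) ou.
Qed.


(** Only the two kinds of limits depend on more than faithfulness of [V], and
    they are hypotheses here. *)
Lemma over_axioms :
  (forall (mu : Tn DI 2 ⇒ TI ∘ TI) (mu' : Tn D 2 ⇒ T ∘ T), over mu mu' -> is_vlift mu' ->
     pointwise_pullback mu (tp DI • pi1 DI) (Tp DI) (tz DI)) ->
  tangent_axioms DI.
Proof.
move=> vlift; have A := tax (tstr X).
have o1 : V ∘ id1 = id1 ∘ V by rewrite comp1_idl comp1_idr.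
have oTT : V ∘ (TI ∘ TI) = T ∘ T ∘ V by rewrite comp1_assoc oT -comp1_assoc oT comp1_assoc.
have e1 : id1 ∘ TI = TI ∘ id1 by rewrite comp1_idl comp1_idr.
split.
- exact: pbI.
- exact: over_heq (over_comp _ _ op oz) (over_idt o1) _ _ (ax_pz A).
- exact: over_heq (over_comp _ _ op os) (over_comp _ _ op (o2 ord0)) _ _ (ax_ps A).
- have [u12 [u23 [v [w [P12 P23 Pv Pw E]]]]] := ax_s_assoc A.
  have [x12 X12 ox12] := over_pairing pb2 pw2 op o2 (o3 _) (o3 _) P12.
  have [x23 X23 ox23] := over_pairing pb2 pw2 op o2 (o3 _) (o3 _) P23.
  have [y Y oy] := over_pairing pb2 pw2 op o2 (over_comp _ _ os ox12) (o3 _) Pv.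
  have [t Ht ot] := over_pairing pb2 pw2 op o2 (o3 _) (over_comp _ _ os ox23) Pw.
  exists x12, x23, y, t; split=> //.
  exact: over_heq (over_comp _ _ os oy) (over_comp _ _ os ot) _ _ E.
- have [u Pu E] := ax_s_comm A.
  have [x Px ox] := over_pairing pb2 pw2 op o2 (o2 _) (o2 _) Pu.
  by exists x => //; apply: over_heq (over_comp _ _ os ox) os _ _ E.
- have [u Pu E] := ax_s_unital A.
  have [x Px ox] := over_pairing pb2 pw2 op o2 (over_idt oT) (over_comp _ _ oz op) Pu.
  by exists x => //; apply: over_heq (over_comp _ _ os ox) (over_idt oT) _ _ E.
- exact: over_heq (over_comp _ _ (over_whl oT op) ol) (over_comp _ _ oz op) _ (comp1_idr _) (ax_lp A).
- exact: over_heq (over_comp _ _ ol oz) (over_comp _ _ (over_whl oT oz) oz) _ _ (ax_lz A).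
- have [u Pu E] := ax_ls A.
  have [x Px ox] := over_pairing Tpb2 Tpw2 (over_whl oT op) (fun k => over_whl oT (o2 k))
    (over_comp _ _ ol (o2 _)) (over_comp _ _ ol (o2 _)) Pu.
  by exists x => //; apply: over_heq (over_comp _ _ ol os)
    (over_comp _ _ (over_whl oT os) ox) _ _ E.
- exact: over_heq (over_comp _ _ (over_whr oT op) oc) (over_whl oT op) _ e1 (ax_cp A).
- exact: over_heq (over_comp _ _ oc (over_whl oT oz)) (over_whr oT oz) (esym e1) _ (ax_cz A).
- have [u Pu E] := ax_cs A.
  have [x Px ox] := over_pairing pb2T pw2T (over_whr oT op) (fun k => over_whr oT (o2 k))
    (over_comp _ _ oc (over_whl oT (o2 _))) (over_comp _ _ oc (over_whl oT (o2 _))) Pu.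
  by exists x => //; apply: over_heq (over_comp _ _ oc (over_whl oT os))
    (over_comp _ _ (over_whr oT os) ox) _ _ E.
- exact: over_heq (over_comp _ _ (over_whl oT ol) ol) (over_comp _ _ (over_whr oT ol) ol)
    _ (comp1_assoc _ _ _) (ax_ll A).
- exact: over_heq (over_comp _ _ oc ol) ol _ _ (ax_cl A).
- exact: over_heq
    (over_comp _ _ (over_comp _ _ (over_whr oT oc) (over_whl oT oc)) (over_whr oT ol))
    (over_comp _ _ (over_whl oT ol) oc) _ (esym (comp1_assoc _ _ _)) (ax_ccl A).
- exact: over_heq (over_comp _ _ oc oc) (over_idt oTT) _ _ (ax_cc A).
- have oc1 := over_whl oT oc; have oc2 := over_whr oT oc.
  exact: over_heq (over_comp _ _ (over_comp _ _ oc1 oc2) oc1)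
    (over_comp _ _ (over_comp _ _ oc2 oc1) oc2)
    (comp1_assoc _ _ _) (comp1_assoc _ _ _) (ax_yb A).
- have [mu' Hmu' _] := ax_vlift A.
  have [mu Hmu omu] := over_vlift Hmu'.
  by exists mu => //; apply: vlift omu Hmu'.
Qed.

End Over.

(** * The tangent structure of an inserter *)

Section InserterTangent.
Variables (K : twocat) (X X' : tangentad K) (F G : lax_mor X X').
Hypotheses (sG : is_strong G) (pG : preserves_ftl (mor1 G)).
Local Notation D := (tdata (tstr X)).
Local Notation D' := (tdata (tstr X')).
Local Notation T := (tT D).
Local Notation T' := (tT D').
Local Notation f := (mor1 F).
Local Notation g := (mor1 G).

Variables (I : K) (V : hom I X) (theta : f ∘ V ⇒ g ∘ V).
Hypothesis ins : is_inserter f g I V theta.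

Definition endoT : endo f g := Endo (dist F) sG.

Lemma endoTn n : 0 < n ->
  exists (a : f ∘ Tn D n ⇒ Tn D' n ∘ f) (b : g ∘ Tn D n ⇒ Tn D' n ∘ g)
    (ib : is_invertible b),
    forall k, @endo_cell _ _ _ f g (Endo a ib) endoT (tpi D n k) (tpi D' n k).
Proof.
move=> n0; have [a Ea] := swapTn F n0; have [b ib Eb] := Tn_comparison sG pG n0.
by exists a, b, ib.
Qed.

(** The fibre powers are chosen together with their comparison 2-morphisms, as
    the sum [ts] is lifted from the quadruple on [Tn 2]. *)
Lemma over_data_exists :
  exists2 DI : tangent_data I, over_data V DI & endo_lift theta endoT (tT DI).
Proof.
have [TI liftT] := endo_lift_exists ins endoT.
have lift1 := endo_lift_id theta.
pose endoTT := endo_comp endoT endoT.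
have liftTT : endo_lift theta endoTT (TI ∘ TI) := endo_lift_comp liftT liftT.
have Tn_ex n : exists (L : hom I I) (pi : 'I_n -> (L ⇒ TI)), 0 < n ->
    (exists (a : f ∘ Tn D n ⇒ Tn D' n ∘ f) (b : g ∘ Tn D n ⇒ Tn D' n ∘ g)
       (ib : is_invertible b),
       (forall k, @endo_cell _ _ _ f g (Endo a ib) endoT (tpi D n k) (tpi D' n k)) /\
       endo_lift theta (Endo a ib) L) /\
    forall k, over V (pi k) (tpi D n k).
  (* [Tn 0] carries no condition. *)
  case: n => [|n]; first by exists TI, (fun=> idt TI).
  have [a [b [ib cells]]] := endoTn (isT : 0 < n.+1).
  have [L liftL] := endo_lift_exists ins (Endo a ib).
  have pi_ex k : exists pi : L ⇒ TI, over V pi (tpi D n.+1 k).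
    by have [h oh] := endo_cell_lift ins liftL liftT (cells k); exists h.
  by have [pi opi] := dependent_choice pi_ex; exists L, pi => _; split=> //; exists a, b, ib.
have [TnI /dependent_choice [piI TnIP]] := dependent_choice Tn_ex.
have [pI op] := endo_cell_lift ins (A := endoT) (B := endo_id f g) (f := tp D) (f' := tp D') liftT lift1
  (conj (swap_p F) (swap_p G)).
have [zI oz] := endo_cell_lift ins (A := endo_id f g) (B := endoT) (f := tz D) (f' := tz D') lift1 liftT
  (conj (swap_z F) (swap_z G)).
have [lI ol] := endo_cell_lift ins (A := endoT) (B := endoTT) (f := tl D) (f' := tl D') liftT liftTT
  (conj (swap_l F) (swap_l G)).
have [cI oc] := endo_cell_lift ins (A := endoTT) (B := endoTT) (f := tc D) (f' := tc D') liftTT liftTT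
  (conj (swap_c F) (swap_c G)).
have [[a [b [ib [cells liftT2]]]] _] := TnIP 2 isT.
have [sI os] := endo_cell_lift ins (A := Endo a ib) (B := endoT) (f := ts D) (f' := ts D') liftT2 liftT
  (conj (swap_s (fun k => (cells k).1)) (swap_s (fun k => (cells k).2))).
exists (@TangentData K I TI pI zI TnI piI sI lI cI) => //; split=> //=.
- by case: liftT.
- by move=> n /TnIP [[? [? [? [_ []]]]]].
- by move=> n /TnIP [].
Qed.

Variables (DI : tangent_data I) (OD : over_data V DI).
Hypothesis liftT : endo_lift theta endoT (tT DI).
Local Notation TI := (tT DI).

Lemma over_iter m : V ∘ iter1 TI m = iter1 T m ∘ V.
Proof.
elim: m => [|m IH] /=; first by rewrite comp1_idl comp1_idr.
by rewrite comp1_assoc (over_T OD) -comp1_assoc IH comp1_assoc.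
Qed.

(** The limits of [X] are pointwise, hence stay limits after restriction along
    [V], which identifies them with the images of the cone on [I]. *)
Lemma over_pw_nfold n (a b P : hom I I) (p : a ⇒ b) (pi : 'I_n -> (P ⇒ a))
    (a' b' P' : hom X X) (p' : a' ⇒ b') (pi' : 'I_n -> (P' ⇒ a')) :
  0 < n -> over V p p' -> (forall k, over V (pi k) (pi' k)) ->
  pointwise_nfold_pullback p' pi' ->
  pointwise_nfold_pullback (g ◁ p') (fun k => g ◁ pi' k) ->
  pointwise_nfold_pullback p pi.
Proof.
move=> n0 op opi pb pbg; apply: (universal_reflects_pw_nfold ins n0).
- by apply: (nfold_transport (Φ := fun _ _ _ p pi => pointwise_nfold_pullback p pi)
    n0 _ _ (pw_nfold_whr V pb)) => [|k]; rewrite tot_whl tot_whr ?op ?opi.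
- apply: (nfold_transport (Φ := fun _ _ _ p pi => pointwise_nfold_pullback p pi)
    n0 _ _ (pw_nfold_whr V pbg)) => [|k];
    by rewrite !tot_whl !tot_whr !tot_whl ?op ?opi mwhr_mwhl.
Qed.

Lemma inserter_Tn_pullbacks : tn_pullbacks DI.
Proof.
move=> n n0; have [pb pbm] := ax_Tn (tax (tstr X)) n0; split=> [|m].
  exact: over_pw_nfold n0 (over_p OD) (over_pi OD n0) pb (pG.1 n n0).
exact: over_pw_nfold n0 (over_whl (over_iter m) (over_p OD))
  (fun k => over_whl (over_iter m) (over_pi OD n0 k)) (pbm m) (preserves_Tn_iter sG pG m n0).
Qed.

Lemma inserter_vlift_pullback (mu : Tn DI 2 ⇒ TI ∘ TI) (mu' : Tn D 2 ⇒ T ∘ T) :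
  over V mu mu' -> is_vlift mu' ->
  pointwise_pullback mu (tp DI • pi1 DI) (Tp DI) (tz DI).
Proof.
move=> omu Hmu'; have [nu' Hnu' pb] := ax_vlift (tax (tstr X)).
rewrite -(is_vlift_uniq Hmu' Hnu') {nu' Hnu'} in pb.
have o1 := over_comp (erefl _) (erefl _) (over_p OD) (over_pi OD (isT : 0 < 2) ord0).
have oTp : over V (Tp DI) (Tp D).
  exact: over_comp (over_idt (over_T OD)) (over_whl (over_T OD) (over_p OD)).
have oz := over_z OD.
apply: (universal_reflects_pw_pullback ins).
- apply: (pullback_transport (Φ := fun _ _ _ _ f g h k => pointwise_pullback f g h k)
    _ _ _ _ (pw_pullback_whr V pb)); by rewrite tot_whl tot_whr ?omu ?o1 ?oTp ?oz.
- apply: (pullback_transport (Φ := fun _ _ _ _ f g h k => pointwise_pullback f g h k)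
    _ _ _ _ (pw_pullback_whr V (pG.2 mu' Hmu')));
  by rewrite !tot_whl !tot_whr !tot_whl ?omu ?o1 ?oTp ?oz mwhr_mwhl.
Qed.

Lemma inserter_tangent_axioms : tangent_axioms DI.
Proof.
exact (over_axioms (universal_faithful ins (Y := I)) OD inserter_Tn_pullbacks
  inserter_vlift_pullback).
Qed.

End InserterTangent.

(** * The universal strict tangent morphism *)

Section StrictOver.
Variables (K : twocat) (X J : tangentad K) (V : hom J X).
Local Notation D := (tdata (tstr X)).
Local Notation DJ := (tdata (tstr J)).
Local Notation T := (tT D).
Local Notation TJ := (tT DJ).
Hypothesis faith : forall Y (A B : hom Y J) (f g : A ⇒ B), V ◁ f = V ◁ g -> f = g.
Hypothesis OD : over_data V DJ.

Lemma over_preserves_ftl : preserves_ftl (X := J) (X' := X) V.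
Proof.
split=> [n n0|mu Hmu].
  have [pb _] := ax_Tn (tax (tstr X)) n0.
  by apply: (nfold_transport (Φ := fun _ _ _ p pi => pointwise_nfold_pullback p pi)
    n0 _ _ (pw_nfold_whr V pb)) => [|k]; rewrite tot_whr tot_whl ?(over_p OD) ?(over_pi OD n0).
have [mu' Hmu' pb] := ax_vlift (tax (tstr X)).
have [nu Hnu onu] := over_vlift (faith (Y := J)) OD (ax_Tn (tax (tstr J))) Hmu'.
rewrite (is_vlift_uniq Hmu Hnu).
have o1 := over_comp (erefl _) (erefl _) (over_p OD) (over_pi OD (isT : 0 < 2) ord0).
have oTp : over V (Tp DJ) (Tp D).
  exact: over_comp (over_idt (over_T OD)) (over_whl (over_T OD) (over_p OD)).
apply: (pullback_transport (Φ := fun _ _ _ _ f g h k => pointwise_pullback f g h k)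
  _ _ _ _ (pw_pullback_whr V pb)); rewrite tot_whr tot_whl.
- by rewrite onu.
- by rewrite o1.
- by rewrite oTp.
- by rewrite (over_z OD).
Qed.

Variables (nu : V ∘ TJ ⇒ T ∘ V) (Enu : tot nu = tot (idt (V ∘ TJ))).

Let Enu' : tot nu = tot (idt (T ∘ V)).
Proof. by rewrite Enu (over_T OD). Qed.

Lemma over_is_lax : is_lax (X := J) (X' := X) nu.
Proof.
have e : T ∘ V ∘ TJ = T ∘ T ∘ V by rewrite -comp1_assoc (over_T OD) comp1_assoc.
split.
- by apply/heq_tot; rewrite tot_compE Enu' mcomp_idr // tot_whr -(over_p OD).
- apply/heq_tot; rewrite tot_compE Enu tot_whl -tot_whl mcomp_idl //.
    by rewrite tot_whl (over_z OD).
- have [u Eu] := recast (idt (V ∘ Tn DJ 2)) erefl (over_Tn OD (isT : 0 < 2)).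
  exists u.
    split; apply: tot_inj; rewrite [LHS]tot_comp [RHS]tot_compE Eu Enu mcomp_idr;
      rewrite ?(over_Tn OD) // mcomp_idl // tot_whr tot_whl;
      exact/esym/over_pi.
  apply/heq_tot; rewrite !tot_compE Eu Enu mcomp_idl // mcomp_idr ?(over_Tn OD) //.
  exact: over_s OD.
- apply/heq_tot; rewrite !tot_compE !tot_whl !tot_whr !Enu' mwhl_idt mwhr_idt (over_l OD).
  by rewrite -!tot_whr e comp1_assoc !(mcomp_idr, mcomp_idl).
- apply/heq_tot; rewrite !tot_compE !tot_whl !tot_whr !Enu' mwhl_idt mwhr_idt (over_c OD).
  by rewrite -!tot_whr e comp1_assoc !(mcomp_idr, mcomp_idl).
Qed.

(** The 2-morphism [nu] is the identity up to the equality
    [V ∘ TJ = T ∘ V]. *)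
Definition strictV : lax_mor J X := LaxMor over_is_lax.

Lemma tot_dist_strictV_comp (Y : tangentad K) (H : lax_mor Y J) :
  tot (dist (tng_comp strictV H)) = mwhl V (tot (dist H)).
Proof.
rewrite tot_comp_dist Enu' mwhr_idt -tot_whl mcomp_idl //.
by rewrite comp1_assoc (over_T OD).
Qed.

Lemma tot_dist_comp_strictV (Y : tangentad K) (H : lax_mor X Y) :
  tot (dist (tng_comp H strictV)) = mwhr V (tot (dist H)).
Proof.
by rewrite tot_comp_dist Enu' mwhl_idt -tot_whr mcomp_idr // comp1_assoc.
Qed.

Section Lift.
Variables (Y : tangentad K) (H : lax_mor Y X) (L : hom Y J).
Local Notation DY := (tdata (tstr Y)).
Local Notation TY := (tT DY).
Local Notation h := (mor1 H).
Variable (gamma : L ∘ TY ⇒ TJ ∘ L).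
Hypotheses (EL : V ∘ L = h) (Egamma : mwhl V (tot gamma) = tot (dist H)).

Let whr_over (A B : hom J J) (x : A ⇒ B) (A' B' : hom X X) (x' : A' ⇒ B') :
  over V x x' -> mwhl V (mwhr L (tot x)) = mwhr h (tot x').
Proof. by move=> ox; rewrite -mwhr_mwhl ox mwhr_mwhr EL. Qed.

Let whl_L (Z : K) (m : mor (hom Z Y)) : mwhl V (mwhl L m) = mwhl h m.
Proof. by rewrite mwhl_mwhl EL. Qed.

Let whl_TJ (Z : K) (m : mor (hom Z J)) : mwhl V (mwhl TJ m) = mwhl T (mwhl V m).
Proof. by rewrite !mwhl_mwhl (over_T OD). Qed.

Let whr_gamma : mwhl V (mwhr TY (tot gamma)) = mwhr TY (tot (dist H)).
Proof. by rewrite -mwhr_mwhl Egamma. Qed.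

Let push := (mwhl_compE, tot_whl, tot_whr, whl_L, whl_TJ,
  whr_over (over_p OD), whr_over (over_z OD), whr_over (over_s OD),
  whr_over (over_l OD), whr_over (over_c OD), Egamma, whr_gamma).

(** Each axiom is reflected from the one for [H].  The additivity axiom comes
    after the projection axiom, which is needed for the pairing to exist. *)
Lemma lift_is_lax : is_lax (X := Y) (X' := J) gamma.
Proof.
have [Lp Lz [u' [u1' u2'] Ls] Ll Lc] := lax_ax H.
have p_gamma : (tp DJ ▷ L) • gamma ≈ L ◁ tp DY.
  apply/heq_tot/(faithful_tot (faith (Y := Y))); rewrite ?comp1_idl ?comp1_idr //.
  by rewrite !push; move/heq_tot: Lp; rewrite tot_compE.
split=> //.
- apply/heq_tot/(faithful_tot (faith (Y := Y))); rewrite ?comp1_idl ?comp1_idr //.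
  by rewrite !push; move/heq_tot: Lz; rewrite tot_compE.
- (* The pairing on [J] is mapped by [V] to the one that comes with [H]. *)
  have pbJ := (ax_Tn (tax (tstr J)) (isT : 0 < 2)).1.2 Y L.
  have [|u [Eu _]] := pbJ.2 _ (fun k => gamma • (L ◁ tpi DY 2 k)).
    move=> i j /=; apply/tot_comp_eq; rewrite !tot_compE !mcompA.
    move/heq_tot: p_gamma; rewrite tot_compE => ->.
    have [[cone _] _] := (ax_Tn (tax (tstr Y)) (isT : 0 < 2)).1.
    by rewrite -!tot_comp -!whl_comp (cone i j).
  exists u; first by split; [exact: Eu ord0 | exact: Eu ord_max].
  have eu : V ∘ (Tn DJ 2 ∘ L) = Tn D 2 ∘ h.
    by rewrite comp1_assoc (over_Tn OD) // -comp1_assoc EL.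
  have [v Ev] := recast (V ◁ u) (etrans (comp1_assoc V L _) (congr1 (comp1^~ _) EL)) eu.
  have Evu : v = u'.
    have pbX := (ax_Tn (tax (tstr X)) (isT : 0 < 2)).1.2 Y h.
    have Epi k : tot (tpi D 2 k ▷ h) ⊙ tot v = tot (dist H) ⊙ tot (h ◁ tpi DY 2 k).
      rewrite Ev tot_whr -(whr_over (over_pi OD (isT : 0 < 2) k)) -tot_whr -mwhl_comp //.
      rewrite -[tot (tpi _ _ _ ▷ _) ⊙ _]tot_comp (_ : comp _ u = gamma • (L ◁ tpi DY 2 k)); last exact: Eu k.
      by rewrite mwhl_compE Egamma tot_whl whl_L.
    apply: (pair_monic pbX); apply/tot_comp_eq; cbv beta; rewrite [LHS]Epi -tot_compE.
      by rewrite -[RHS]tot_comp u1'.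
    by rewrite -[RHS]tot_comp u2'.
  apply/heq_tot/(faithful_tot (faith (Y := Y))); rewrite ?comp1_assoc //.
  rewrite !push -[mwhl V (tot u)]tot_whl -Ev Evu.
  by move/heq_tot: Ls; rewrite !tot_compE.
- apply/heq_tot/(faithful_tot (faith (Y := Y))); rewrite ?comp1_assoc //.
  by rewrite !push; move/heq_tot: Ll; rewrite !tot_compE.
- apply/heq_tot/(faithful_tot (faith (Y := Y))); rewrite ?comp1_assoc //.
  by rewrite !push; move/heq_tot: Lc; rewrite !tot_compE.
Qed.

End Lift.
End StrictOver.

(** * The universal property among tangentads *)

Section TngCells.
Variable K : twocat.

Lemma tot_cell2_compE (X X' : tangentad K) (A B B' C : tng_hom X X') (e : strict B B')
    (psi : B' ⇒ C) (phi : A ⇒ B) :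
  tot (cell2 (@compE _ _ _ _ _ e psi phi)) = tot (cell2 psi) ⊙ tot (cell2 phi).
Proof. by case: _ / e psi => psi; rewrite compE_comp tot_comp. Qed.

Lemma cell2_heq (X X' : tangentad K) (A B A' B' : tng_hom X X') (phi : A ⇒ B) (psi : A' ⇒ B') :
  phi ≈ psi -> cell2 phi ≈ cell2 psi.
Proof. by case. Qed.

Lemma cell2_insert_cell (X X' J : tangentad K) (F G : lax_mor X X') (V : lax_mor J X)
    (theta : @arr (tng_hom J X') (tng_comp F V) (tng_comp G V)) Y (H : lax_mor Y J) :
  cell2 (@insert_cell (Tng K) X X' F G Y J V theta H) =
  insert_cell (cell2 theta) (mor1 H).
Proof.
apply: tot_inj; rewrite tot_insert_cell.
rewrite (tot_cell2_compE (C := tng_comp G (tng_comp V H))).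
rewrite (tot_cell2_compE (B' := tng_comp G (tng_comp V H))).
by rewrite mcomp_idl ?mcomp_idr //= ?comp1_assoc.
Qed.

End TngCells.

Section TngInserter.
Variables (K : twocat) (X X' J : tangentad K) (F G : lax_mor X X') (sG : is_strong G).
Local Notation D := (tdata (tstr X)).
Local Notation D' := (tdata (tstr X')).
Local Notation DJ := (tdata (tstr J)).
Local Notation T := (tT D).
Local Notation T' := (tT D').
Local Notation TJ := (tT DJ).
Local Notation f := (mor1 F).
Local Notation g := (mor1 G).
Variables (V : hom J X) (theta : f ∘ V ⇒ g ∘ V).
Hypotheses (ins : is_inserter f g J V theta) (OD : over_data V DJ).
Hypothesis liftT : endo_lift theta (endoT F sG) TJ.
Variables (nu : V ∘ TJ ⇒ T ∘ V) (Enu : tot nu = tot (idt (V ∘ TJ))).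
Local Notation VT := (strictV OD Enu).

Lemma universal_is_tangent2 : is_tangent2 (tng_comp F VT) (tng_comp G VT) theta.
Proof.
apply/heq_tot; rewrite tot_compE [in RHS]tot_compE.
rewrite (tot_dist_comp_strictV OD Enu F) (tot_dist_comp_strictV OD Enu G).
by case: liftT.
Qed.

(** The tangent 2-morphism equation of [theta], restricted along [L]. *)
Let dist_eq (Y : tangentad K) (H : lax_mor Y X) (L : hom Y J) : V ∘ L = mor1 H ->
  mwhr (mor1 H) (tot (dist G)) ⊙ mwhr (TJ ∘ L) (tot theta) =
  mwhl T' (mwhr L (tot theta)) ⊙ mwhr (mor1 H) (tot (dist F)).
Proof.
move=> EL; have [_ E] := liftT; rewrite /= in E.
have := congr1 (mwhr L) E; rewrite -!tot_whr -!tot_whl.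
rewrite !mwhr_comp; first by rewrite !mnorm EL.
- by rewrite comp1_assoc.
- by rewrite -!comp1_assoc (over_T OD).
Qed.

(** The distributive 2-morphism of [H] commutes with the inserted cells, up to
    the invertible [dist G], exactly because [tau] is a tangent
    2-morphism. *)
Lemma tng_lifts_obs (Y : tangentad K) (H : lax_mor Y X)
    (tau : tangent2 (tng_comp F H) (tng_comp G H)) :
  exists2 L : lax_mor Y J, tng_comp VT L = H & theta ▷ mor1 L ≈ cell2 tau.
Proof.
have [_ obs ff] := (is_inserterP _).1 ins.
have [L EL Et] := obs _ (mor1 H) (cell2 tau).
have e1 : mor1 H ∘ tT (tstr Y) = V ∘ (L ∘ tT (tstr Y)) by rewrite comp1_assoc EL.
have e2 : T ∘ mor1 H = V ∘ (TJ ∘ L) by rewrite comp1_assoc (over_T OD) -comp1_assoc EL.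
have [gamma' Egamma'] := recast (dist H) e1 e2.
have [|gamma [Egamma _]] := ff _ _ _ gamma'.
  apply/tot_comp_eq; rewrite !tot_insert_cell !tot_whl Egamma'.
  have [d [d1 _]] := sG.
  have key : mwhr (mor1 H) (tot (dist G)) ⊙
      (mwhr (TJ ∘ L) (tot theta) ⊙ mwhl f (tot (dist H))) =
      mwhr (mor1 H) (tot (dist G)) ⊙
      (mwhl g (tot (dist H)) ⊙ mwhr (L ∘ tT (tstr Y)) (tot theta)).
    rewrite !mcompA dist_eq // -mwhr_mwhr -tot_whr ((heq_tot _ _).1 Et).
    have := (heq_tot _ _).1 (tangent2_ax tau); rewrite tot_compE [in RHS]tot_compE.
    by rewrite !tot_comp_dist !mcompA => ->.
  move/(congr1 (fun m => mwhr (mor1 H) (tot d) ⊙ m)): key; rewrite !mcompA.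
  rewrite -mwhr_comp // -tot_comp d1 mwhr_idt -!tot_whr -!tot_whl.
  rewrite mcomp_idl; last by rewrite -EL !comp1_assoc -(comp1_assoc g V) (over_T OD) !comp1_assoc.
  by rewrite mcomp_idl // comp1_assoc.
have Eg : mwhl V (tot gamma) = tot (dist H) by rewrite -tot_whl Egamma.
pose L' := LaxMor (lift_is_lax (universal_faithful ins) OD EL Eg).
exists L' => //; apply: lax_mor_eq => //; apply/heq_tot.
by rewrite (tot_dist_strictV_comp OD Enu L').
Qed.

Lemma tng_lifts_inj (Y : tangentad K) (H L : lax_mor Y J) :
  tng_comp VT H = tng_comp VT L -> theta ▷ mor1 H ≈ theta ▷ mor1 L -> H = L.
Proof.
move=> E Et; have [inj _ _] := (is_inserterP _).1 ins.
have e : mor1 H = mor1 L by apply: inj Et; have := congr1 (@mor1 _ _ _) E.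
apply: lax_mor_eq => //; apply/heq_tot.
apply: (universal_reflects_tot ins); rewrite ?e //.
rewrite -(tot_dist_strictV_comp OD Enu H) -(tot_dist_strictV_comp OD Enu L).
by rewrite E.
Qed.

Lemma tng_is_inserter :
  @is_inserter (Tng K) X X' F G J VT (Tangent2 universal_is_tangent2).
Proof.
have [_ _ ff] := (is_inserterP _).1 ins.
apply/is_inserterP; split=> [Y H L E|Y H tau|Y H L phi].
- by move/cell2_heq; apply: tng_lifts_inj.
- have [L EL Et] := tng_lifts_obs tau; exists L => //.
  apply: tng_heq => //.
  + by rewrite /= -EL; apply/esym/tng_assoc.
  + by rewrite /= -EL; apply/esym/tng_assoc.
- move=> Ephi.
  have E : comp (insert_cell theta (mor1 L)) (f ◁ cell2 phi) =
           comp (g ◁ cell2 phi) (insert_cell theta (mor1 H)).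
    have cell := @cell2_insert_cell K X X' J F G VT (Tangent2 universal_is_tangent2) Y.
    rewrite -[insert_cell _ (mor1 L)]cell -[insert_cell _ (mor1 H)]cell.
    exact (congr1 (@cell2 _ _ _ _ _) Ephi).
  have [psi [Epsi u]] := ff _ _ _ _ E.
  have Ht : is_tangent2 H L psi.
    apply/heq_tot/(universal_reflects_tot ins) => //.
    rewrite !mwhl_compE tot_whl tot_whr -mwhr_mwhl mwhl_mwhl (over_T OD) -mwhl_mwhl.
    rewrite -!(tot_dist_strictV_comp OD Enu) -tot_whl Epsi.
    by have := (heq_tot _ _).1 (tangent2_ax phi); rewrite tot_compE [in RHS]tot_compE.
  exists (Tangent2 Ht); split; first exact: tangent2_eq.
  by move=> psi' E'; apply: tangent2_eq; apply: u; have := congr1 (@cell2 _ _ _ _ _) E'.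
Qed.

End TngInserter.

(** * Strong morphisms and sub-2-categories *)

Section Reflects.
Variables (K : twocat) (X X' J : tangentad K) (F G : lax_mor X X').
Hypotheses (sG : is_strong G) (pG : preserves_ftl (mor1 G)).
Variables (V : hom J X) (theta : mor1 F ∘ V ⇒ mor1 G ∘ V).
Hypotheses (ins : is_inserter (mor1 F) (mor1 G) J V theta).
Hypothesis OD : over_data V (tdata (tstr J)).
Variables (nu : V ∘ tT (tstr J) ⇒ tT (tstr X) ∘ V).
Hypothesis Enu : tot nu = tot (idt (V ∘ tT (tstr J))).
Local Notation VT := (strictV OD Enu).
Variables (Y : tangentad K) (H : lax_mor Y J).
Local Notation DY := (tdata (tstr Y)).

Lemma strictV_strong : is_strong VT.
Proof.
have [mu Emu] := recast (idt (V ∘ tT (tstr J))) (over_T OD) erefl.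
exists mu; split; apply: tot_inj; rewrite tot_comp Enu Emu mcomp_idl //.
by rewrite (over_T OD).
Qed.

Lemma strictV_reflects_strong : is_strong (tng_comp VT H) -> is_strong H.
Proof.
move=> [d [d1 d2]]; apply: (universal_reflects_inv ins).
have e1 : V ∘ mor1 H ∘ tT DY = V ∘ (mor1 H ∘ tT DY) by rewrite comp1_assoc.
have e2 : tT (tstr X) ∘ (V ∘ mor1 H) = V ∘ (tT (tstr J) ∘ mor1 H).
  by rewrite !comp1_assoc (over_T OD).
have [c Ec] := recast d e2 e1; have E := tot_dist_strictV_comp OD Enu H.
exists c; split; apply: tot_inj; rewrite tot_comp Ec tot_whl -E -tot_comp.
- by rewrite d1; apply: tot_idt.
- by rewrite d2; apply: tot_idt.
Qed.

(** Strength of the composite is used to know that composing further with [G]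
    preserves the limits again, as required for reflection. *)
Lemma strictV_reflects_ftl :
  is_strong (tng_comp VT H) -> preserves_ftl (V ∘ mor1 H) -> preserves_ftl (mor1 H).
Proof.
move=> sVH pVH; have pGVH := preserves_ftl_comp (F := tng_comp VT H) (G := G) sVH pVH pG.
split=> [n n0|mu Hmu].
- apply: (universal_reflects_pw_nfold ins n0).
  + by apply: (nfold_transport (Φ := fun _ _ _ p pi => pointwise_nfold_pullback p pi)
      n0 _ _ (pVH.1 n n0)) => [|k]; rewrite !tot_whl !mwhl_mwhl.
  + by apply: (nfold_transport (Φ := fun _ _ _ p pi => pointwise_nfold_pullback p pi)
      n0 _ _ (pGVH.1 n n0)) => [|k]; rewrite !tot_whl !mwhl_mwhl mwhl_assoc.
- apply: (universal_reflects_pw_pullback ins).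
  + by apply: (pullback_transport
      (Φ := fun _ _ _ _ f g h k => pointwise_pullback f g h k) _ _ _ _ (pVH.2 mu Hmu));
      rewrite !tot_whl !mwhl_mwhl.
  + by apply: (pullback_transport
      (Φ := fun _ _ _ _ f g h k => pointwise_pullback f g h k) _ _ _ _ (pGVH.2 mu Hmu));
      rewrite !tot_whl !mwhl_mwhl mwhl_assoc.
Qed.

End Reflects.

Section SubInserter.
Variables (K : twocat) (P : forall X Y : K, hom X Y -> Prop).
Hypothesis Pid : forall X : K, P (@id1 K X).
Hypothesis Pcomp : forall (X Y Z : K) (H : hom Y Z) (F : hom X Y),
  P H -> P F -> P (H ∘ F).
Local Notation S := (sub2 Pid Pcomp).

Lemma tot_sub_compE (X Y : K) (A B B' C : sub_hom P X Y) (e : strict B B')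
    (psi : B' ⇒ C) (phi : A ⇒ B) :
  @tot (hom X Y) (sub1 A) (sub1 C) (@compE _ _ _ _ _ e psi phi) =
  @tot (hom X Y) (sub1 B') (sub1 C) psi ⊙ @tot (hom X Y) (sub1 A) (sub1 B) phi.
Proof. by case: _ / e psi => psi; rewrite compE_comp -tot_comp. Qed.

Lemma sub_heq_tot (X Y : K) (A B A' B' : sub_hom P X Y) (phi : A ⇒ B) (psi : A' ⇒ B') :
  phi ≈ psi ->
  @heq (hom X Y) (sub1 A) (sub1 B) phi (sub1 A') (sub1 B') psi.
Proof. by case. Qed.

(** Restricting to a class of 1-morphisms keeps all 2-morphisms, so only the
    lifts of 1-morphisms have to be checked to stay in the class. *)
Lemma sub_has_inserter (X X' : S) (F G : hom X X') (J : K) (V : @hom K J X)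
    (theta : @comp1 K _ _ _ (sub1 F) V ⇒ @comp1 K _ _ _ (sub1 G) V) :
  is_inserter (sub1 F) (sub1 G) J V theta ->
  P V -> (forall (Y : K) (H : @hom K Y J), P (@comp1 K _ _ _ V H) -> P H) ->
  has_inserter F G.
Proof.
move=> /is_inserterP [inj obs ff] PV refl.
pose VS : @hom S J X := SubMor PV.
exists J, VS, theta.
have cell (Y : K) (H : @hom S Y J) :
    @insert_cell S X X' F G Y J VS theta H = @insert_cell K X X' (sub1 F) (sub1 G) Y J V theta (sub1 H).
  apply: (@tot_inj (@hom K Y X')); rewrite (@tot_insert_cell K).
  rewrite (tot_sub_compE (C := G ∘ (VS ∘ H))).
  rewrite (tot_sub_compE (B' := G ∘ (VS ∘ H))).
  by rewrite mcomp_idl ?mcomp_idr //= ?comp1_assoc.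
apply/is_inserterP; split=> [Y H L E|Y H tau|Y H L phi E].
- move/sub_heq_tot => Et; apply: sub_mor_eq; apply: inj Et.
  by have := congr1 (@sub1 _ _ _ _) E.
- have [L EL Et] := obs Y (sub1 H) tau.
  have PL : P L by apply: refl; rewrite EL; apply: sub_ax.
  have ES : VS ∘ (SubMor PL : @hom S Y J) = H by apply: sub_mor_eq.
  exists (SubMor PL) => //; apply: sub_heq => //; rewrite -ES.
  + exact/esym/(@comp1_assoc S).
  + exact/esym/(@comp1_assoc S).
- by apply: ff; rewrite -!cell.
Qed.

End SubInserter.

(** * Inserters of tangentads *)

Lemma inserter_tangent_structure (K : twocat) (X X' : tangentad K) (F G : lax_mor X X')
    (sG : is_strong G) (pG : preserves_ftl (mor1 G)) (I : K) (V : hom I X)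
    (theta : mor1 F ∘ V ⇒ mor1 G ∘ V) :
  is_inserter (mor1 F) (mor1 G) I V theta ->
  exists TI : tangent_structure I,
    [/\ over_data V TI, endo_lift theta (endoT F sG) (tT TI) &
        exists nu : V ∘ tT TI ⇒ tT (tstr X) ∘ V, tot nu = tot (idt (V ∘ tT TI))].
Proof.
move=> ins; have [DI OD liftT] := over_data_exists sG pG ins.
exists (TangentStructure (inserter_tangent_axioms sG pG ins OD)); split=> //.
by have [nu Enu] := recast (idt (V ∘ tT DI)) erefl (over_T OD); exists nu.
Qed.

Theorem proposition4p4 (K : twocat) :
  (forall (X X' : tangentad K) (F G : lax_mor X X'),
     is_strong G -> preserves_ftl (mor1 G) ->
     forall (I : K) (V : hom I X) (theta : mor1 F ∘ V ⇒ mor1 G ∘ V),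
       is_inserter (mor1 F) (mor1 G) I V theta ->
       exists TI : tangent_structure I,
       exists nu : V ∘ tT TI ⇒ tT (tstr X) ∘ V,
       exists Hnu : @is_lax K (Tangentad TI) X V nu,
         is_strict (LaxMor Hnu) /\
         @preserves_ftl K (Tangentad TI) X V /\
         exists Htheta : is_tangent2 (tng_comp F (LaxMor Hnu))
                                     (tng_comp G (LaxMor Hnu)) theta,
           @is_inserter (Tng K) X X' F G
             (Tangentad TI) (LaxMor Hnu) (Tangent2 Htheta)) /\
  (admits_inserters K ->
     (forall (X X' : Tng_strong K) (F G : hom X X'),
        preserves_ftl (mor1 (sub1 G)) -> has_inserter F G) /\
     admits_inserters (Tng_strong_ftl K)).
Proof.
split=> [X X' F G sG pG I V theta ins|inserters].
  have [TI [OD liftT [nu Enu]]] := inserter_tangent_structure sG pG ins.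
  exists TI, nu, (over_is_lax (J := Tangentad TI) OD Enu); split; last split.
  - exact/heq_tot.
  - exact: (over_preserves_ftl (J := Tangentad TI) (universal_faithful ins) OD).
  - exists (universal_is_tangent2 (J := Tangentad TI) OD liftT Enu).
    exact: (tng_is_inserter (J := Tangentad TI) ins).
split=> [X X' F G pG|X X' F G].
  have [I [V [theta ins]]] := inserters _ _ (mor1 (sub1 F)) (mor1 (sub1 G)).
  have [TI [OD liftT [nu Enu]]] := inserter_tangent_structure (sub_ax G) pG ins.
  apply: (sub_has_inserter (tng_is_inserter (J := Tangentad TI) ins OD liftT Enu)).
  - exact: strictV_strong.
  - by move=> Y H; apply: (strictV_reflects_strong (J := Tangentad TI) ins).
have [sG pG] := sub_ax G.
have [I [V [theta ins]]] := inserters _ _ (mor1 (sub1 F)) (mor1 (sub1 G)).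
have [TI [OD liftT [nu Enu]]] := inserter_tangent_structure sG pG ins.
apply: (sub_has_inserter (tng_is_inserter (J := Tangentad TI) ins OD liftT Enu)).
- split; first exact: strictV_strong.
  exact: (over_preserves_ftl (J := Tangentad TI) (universal_faithful ins) OD).
- move=> Y H [sVH pVH]; split.
    exact: (strictV_reflects_strong (J := Tangentad TI) ins sVH).
  exact: (strictV_reflects_ftl (J := Tangentad TI) pG ins sVH pVH).
Qed.
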